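(* Let $\bar u\in U_{ad}$, $\bar y\in H^1_0(\Omega)$, $\bar p\in L^2(\Omega)$ and $\bar\mu\in\mathcal M(K)$ be such that $\bar y_{|K}\in Y_{ad}$ and $$\int_\Omega\nabla\bar y\cdot\nabla v+\phi(\bar y)v\,dx=\int_\Omega\bar u v\,dx\qquad\forall\, v\in H^1_0(\Omega),$$ $$\int_\Omega\bar p(-\Delta v)+\phi'(\bar y)\bar p v\,dx=\int_\Omega(\bar y-y_0)v\,dx+\int_K v\,d\bar\mu\qquad\forall\, v\in H^1_0(\Omega)\cap H^2(\Omega),$$ $$\int_\Omega(\bar p+\alpha\bar u)(u-\bar u)\,dx\ge0\qquad\forall\, u\in U_{ad},$$ $$\int_K(z-\bar y)\,d\bar\mu\le0\qquad\forall\, z\in Y_{ad}.$$ If $$\|\bar p\|_{L^q(\Omega)}\le\eta(\alpha,r),$$ then $\bar u$ is a global minimum for Problem $(\mathbb P)$. If this inequality is strict, then $\bar u$ is the unique global minimum of $(\mathbb P)$.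
   Context: Data. $\Omega\subset\mathbb R^2$ is a bounded, convex, polygonal domain; $\alpha>0$; $y_0\in L^2(\Omega)$. The function $\phi:\mathbb R\to\mathbb R$ is of class $C^2$ and monotonically increasing (so $\phi'\ge 0$), and there are constants $r>1$ and $M>0$ with $|\phi''(s)|\le M\,\phi'(s)^{1/r}$ for all $s\in\mathbb R$. $K\subset\Omega$ is a (possibly empty) compact set, $y_a,y_b\in C_0(\Omega)$ (continuous functions on $\bar\Omega$ vanishing on $\partial\Omega$) with $y_a(x)<y_b(x)$ for $x\in K$, and $Y_{ad}=\{z\in C(K): y_a(x)\le z(x)\le y_b(x)\ \forall x\in K\}$. With given constants $-\infty\le u_a\le u_b\le\infty$, $U_{ad}=\{u\in L^2(\Omega): u_a\le u(x)\le u_b\text{ a.e. in }\Omega\}$. $\mathcal M(K)$ is the space of (signed) regular Borel measures on $K$. For $u\in L^2(\Omega)$, $\mathcal G(u)\in H^1_0(\Omega)\cap H^2(\Omega)$ denotes the unique solution $y$ of $-\Delta y+\phi(y)=u$ in $\Omega$, $y=0$ on $\partial\Omega$ (so $\mathcal G(u)\in C(\bar\Omega)$). Problem $(\mathbb P)$: minimize $J(u)=\frac12\|y-y_0\|_{L^2(\Omega)}^2+\frac\alpha2\|u\|_{L^2(\Omega)}^2$ over $u\in U_{ad}$ subject to $y=\mathcal G(u)$ and $y_{|K}\in Y_{ad}$. A global minimum is a feasible control $\bar u$ with $J(\bar u)\le J(u)$ for all feasible $u$. Constants. $q:=\frac{3r-2}{r-1}$, $\rho:=\frac{r+q}{rq}$,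 and $C_q>0$ is an upper bound on the optimal constant $C$ in the Gagliardo–Nirenberg inequality $\|f\|_{L^q(\mathbb R^2)}\le C\|f\|_{L^2(\mathbb R^2)}^{2/q}\|\nabla f\|_{L^2(\mathbb R^2)}^{(q-2)/q}$, $f\in H^1(\mathbb R^2)$. Finally $$\eta(\alpha,r):=\alpha^{\frac\rho2}\,C_q^{\frac{2-2r}{r}}\,M^{-1}\Big(\frac{r-1}{2r-1}\Big)^{\frac{1-r}{r}}q^{1/q}\,r^{1/r}\,\rho^{\rho/2}\,(2-\rho)^{\frac\rho2-1}.$$ *)

(* Defs.v *)
From HB Require Import structures.
From mathcomp Require Import all_boot all_order all_algebra.
From mathcomp Require Import all_classical all_reals all_analysis.
Set Implicit Arguments.
Unset Strict Implicit.
Unset Printing Implicit Defensive.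
Import Order.TTheory GRing.Theory Num.Theory.
Import numFieldNormedType.Exports.
Local Open Scope classical_set_scope.
Local Open Scope ring_scope.

(* Functions on an open set Omega are total functions on the plane, of which
   only the values on Omega (on its closure for continuous functions, on K for
   elements of C(K)) matter.  Elements of Lebesgue and Sobolev spaces are
   represented by functions instead of classes modulo equality a.e. *)

Notation plane R := (measurableTypeR R * measurableTypeR R)%type.

Section Domains.
Context {R : realType}.
Implicit Type Omega : set (plane R).

Definition leb2 : {measure set (plane R) -> \bar R} :=
  (@lebesgue_measure R \x @lebesgue_measure R)%E.

Definition boundary Omega : set (plane R) := closure Omega `\` interior Omega.

Definition segment (a b : plane R) : set (plane R) :=
  [set x | exists2 t : R, 0 <= t <= 1 & x = (1 - t) *: a + t *: b].

Definition polygonal Omega : Prop :=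
  exists s : seq (plane R * plane R),
    boundary Omega = \bigcup_(ab in [set` s]) segment ab.1 ab.2.

(* Connectedness is implied by convexity. *)
Definition convex_polygonal_domain Omega : Prop :=
  [/\ open Omega, Omega !=set0, bounded_set Omega, convex_set Omega
    & polygonal Omega].

Definition C0 Omega (f : plane R -> R) : Prop :=
  {within closure Omega, continuous f} /\ forall x, boundary Omega x -> f x = 0.

End Domains.

Section Sobolev.
Context {R : realType}.
Implicit Types (Omega : set (plane R)) (f g psi : plane R -> R).

Definition normL Omega (p : R) f : \bar R :=
  'N[@leb2 R]_(p%:E)[EFin \o (f \_ Omega)]%E.

Definition L2 Omega f : Prop := f \_ Omega \in Lfun (@leb2 R) 2%:E.

Definition e_ (i : bool) : plane R := if i then (0, 1) else (1, 0).

Fixpoint iter_partial (s : seq bool) f : plane R -> R :=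
  if s is i :: s' then fun x => 'D_(e_ i) (iter_partial s' f) x else f.

Definition smooth f : Prop := forall s : seq bool,
  continuous (iter_partial s f) /\
  forall i x, derivable (iter_partial s f) x (e_ i).

Definition closed_support f : set (plane R) := closure [set x | f x != 0].

Definition test_function Omega psi : Prop :=
  [/\ smooth psi, compact (closed_support psi) & closed_support psi `<=` Omega].

Definition is_weak_partial Omega (i : bool) f g : Prop :=
  L2 Omega g /\
  forall psi, test_function Omega psi ->
    \int[@leb2 R]_(x in Omega) (f x * 'D_(e_ i) psi x) =
    - \int[@leb2 R]_(x in Omega) (g x * psi x).

(* A representative of the weak derivative, which is unique up to equality
   a.e. in Omega; the null function if there is no weak derivative in L2. *)
Definition wpartial Omega (i : bool) f : plane R -> R :=
  xget (fun=> 0) [set g | is_weak_partial Omega i f g].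

Definition H1 Omega f : Prop :=
  L2 Omega f /\ forall i, exists g, is_weak_partial Omega i f g.

Definition H2 Omega f : Prop :=
  H1 Omega f /\ forall i, H1 Omega (wpartial Omega i f).

(* The closure of the test functions in H1. *)
Definition H10 Omega f : Prop :=
  H1 Omega f /\
  exists psi : nat -> plane R -> R,
    [/\ forall n, test_function Omega (psi n),
        (fun n => normL Omega 2 (psi n \- f)) @ \oo --> 0%E
      & forall i, (fun n => normL Omega 2
          (fun x => 'D_(e_ i) (psi n) x - wpartial Omega i f x)) @ \oo --> 0%E].

Definition grad_dot Omega f g : plane R -> R :=
  fun x => \sum_(i : bool) wpartial Omega i f x * wpartial Omega i g x.

Definition laplacian Omega f : plane R -> R :=
  fun x => \sum_(i : bool) wpartial Omega i (wpartial Omega i f) x.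

(* H10 `&` H2, an element being represented by its continuous version on the
   closure of Omega (Sobolev embedding), so that its values on K make sense. *)
Definition H10_H2 Omega f : Prop :=
  [/\ H10 Omega f, H2 Omega f & {within closure Omega, continuous f}].

Definition GN_inequality (q C : R) : Prop :=
  forall f, H1 setT f ->
    (normL setT q f <= C%:E * normL setT 2 f `^ (2 / q) *
      normL setT 2 (fun x => Num.sqrt (grad_dot setT f f x)) `^ ((q - 2) / q))%E.

(* +oo if there is no admissible constant *)
Definition GN_optimal_constant (q : R) : \bar R :=
  ereal_inf [set C%:E | C in [set C | 0 <= C /\ GN_inequality q C]].

End Sobolev.

Section SignedMeasures.
Context {R : realType}.
Implicit Types (K : set (plane R)) (mu : {charge set (plane R) -> \bar R}).

(* A signed Borel measure on K is a charge on the plane that vanishes off K;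
   charges are finite, and regularity is automatic in the plane. *)
Definition measure_on K mu : Prop :=
  forall A : set (plane R), measurable A -> A `<=` ~` K -> mu A = 0%E.

(* Integral through the Jordan decomposition, which does not depend on the
   choice of the Hahn decomposition. *)
Definition charge_integral mu K (f : plane R -> R) : R :=
  let PN := cid (Hahn_decomposition mu) in
  let N := cid (svalP PN) in
  \int[jordan_pos (svalP N)]_(x in K) f x -
  \int[jordan_neg (svalP N)]_(x in K) f x.

End SignedMeasures.

Section ControlProblem.
Context {R : realType}.
Implicit Types (Omega K : set (plane R)) (phi : R -> R).
Implicit Types (y ya yb u : plane R -> R) (ua ub : \bar R).
Implicit Type G : (plane R -> R) -> (plane R -> R).

Definition C2 phi : Prop :=
  [/\ forall s, derivable phi s 1, forall s, derivable (derive1 phi) s 1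
    & continuous (derive1n 2 phi)].

Definition Yad K ya yb : set (plane R -> R) :=
  [set z | {within K, continuous z} /\ forall x, K x -> ya x <= z x <= yb x].

Definition Uad Omega ua ub : set (plane R -> R) :=
  [set u | L2 Omega u /\
     {ae @leb2 R, forall x, Omega x -> (ua <= (u x)%:E <= ub)%E}].

Definition state_equation Omega phi u y : Prop :=
  H10_H2 Omega y /\
  {ae @leb2 R, forall x, Omega x -> - laplacian Omega y x + phi (y x) = u x}.

(* G maps u to the solution of the state equation, which is unique since phi
   is nondecreasing. *)
Definition solution_operator Omega phi G : Prop :=
  forall u, L2 Omega u -> state_equation Omega phi u (G u).

Definition J Omega G (y0 : plane R -> R) (alpha : R) u : R :=
  2^-1 * fine (normL Omega 2 (G u \- y0)) ^+ 2 +
  alpha / 2 * fine (normL Omega 2 u) ^+ 2.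

Definition feasible Omega K G ya yb ua ub : set (plane R -> R) :=
  [set u | Uad Omega ua ub u /\ Yad K ya yb (G u)].

Definition global_minimum Omega K G y0 alpha ya yb ua ub u : Prop :=
  feasible Omega K G ya yb ua ub u /\
  forall v, feasible Omega K G ya yb ua ub v ->
    J Omega G y0 alpha u <= J Omega G y0 alpha v.

End ControlProblem.

Section Constants.
Context {R : realType}.
Implicit Types r alpha Cq M : R.

Definition q_ r : R := (3 * r - 2) / (r - 1).

Definition rho r : R := (r + q_ r) / (r * q_ r).

Definition eta_ alpha r Cq M : R :=
  alpha `^ (rho r / 2) * Cq `^ ((2 - 2 * r) / r) * M^-1 *
  ((r - 1) / (2 * r - 1)) `^ ((1 - r) / r) *
  q_ r `^ (1 / q_ r) * r `^ (1 / r) *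
  rho r `^ (rho r / 2) * (2 - rho r) `^ (rho r / 2 - 1).

End Constants.

(* Main.v *)
(* For a feasible u with state y, put v = y - ybar, w = u - ubar and let Rem be the
   first order Taylor remainder of phi at ybar in direction v.  The optimality
   system, with v as test function in the adjoint equation and z = y in the
   complementarity condition, yields
     J(u) - J(ubar) >= |v|^2 / 2 + alpha |w|^2 / 2 - int |pbar| |Rem|.
   The condition on phi'' gives, with D = phi(y) - phi(ybar),
     |Rem| <= M ((r-1)/(2r-1))^((r-1)/r) |v|^(2-2/r) (D v)^(1/r),
   and Hölder with exponents q, q/(2-2/r), r bounds the last integral by the L^q
   norms of pbar and v and by B = int D v.  Gagliardo-Nirenberg for the extension
   of v by zero, the energy identity |grad v|^2 + B = int w v and Young's
   inequality (used twice) turn this bound into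
   (|pbar|_q / eta) (|v|^2 + alpha |w|^2) / 2.

   That ybar is the state G(ubar) follows by testing with the difference, whose
   gradient vanishes; Gagliardo-Nirenberg then replaces the Poincaré inequality.
   Since [wpartial] is an arbitrary representative of the weak derivative, its
   linearity holds only a.e., by the fundamental lemma of the calculus of
   variations. *)

Require Import Defs.
From HB Require Import structures.
From mathcomp Require Import all_boot all_order all_algebra.
From mathcomp Require Import all_classical all_reals all_analysis.
From mathcomp Require Import measurable_realfun ring lra.
Set Implicit Arguments.
Unset Strict Implicit.
Unset Printing Implicit Defensive.
Import Order.TTheory GRing.Theory Num.Theory.
Import numFieldNormedType.Exports.
Local Open Scope classical_set_scope.
Local Open Scope ring_scope.

(** * Boxes and the plane measure *)

(** The exponent q is forced: Hölder requires 1/q + (2 - 2/r)/q + 1/r = 1, and [q_ r] is this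
    equation solved for q. In dimension two Gagliardo-Nirenberg then turns |v|_q^(2 - 2/r) into a
    multiple of |v|^(2 - 2 rho) A^(1/q), where A = |grad v|^2 and rho = 1/q + 1/r. Young bounds
    A^(1/q) B^(1/r) by a multiple of (A + B)^rho, hence of (|w| |v|)^rho. The outcome |w|^rho |v|^(2
    - rho) is homogeneous of degree two, so a second Young inequality compares it with the quadratic
    part of the cost. [eta_] collects the reciprocals of the constants of these steps. The measure
    enters only through the integral of the single function [G u \- ybar], which the adjoint
    equation and the complementarity condition share. Weak derivatives rest on a supply of test
    functions. Products of one-variable bumps on boxes suffice, because countably many rational
    boxes cover an open set. *)

Section PlaneMeasure.
Context {R : realType}.
Implicit Types (A : set (plane R)) (x : plane R).

Definition obox (a b c d : R) : set (plane R) := `]a, b[%classic `*` `]c, d[%classic.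
Definition cbox (a b c d : R) : set (plane R) := `[a, b]%classic `*` `[c, d]%classic.

Lemma continuous_fst2 : continuous (fst : plane R -> R).
Proof. by move=> x; exact: cvg_fst. Qed.

Lemma continuous_snd2 : continuous (snd : plane R -> R).
Proof. by move=> x; exact: cvg_snd. Qed.

Lemma oboxP a b c d x : obox a b c d x <-> (a < x.1 < b) /\ (c < x.2 < d).
Proof. by rewrite /obox /= !in_itv. Qed.

Lemma cboxP a b c d x : cbox a b c d x <-> (a <= x.1 <= b) /\ (c <= x.2 <= d).
Proof. by rewrite /cbox /= !in_itv. Qed.

Lemma sub_obox_cbox a b c d : obox a b c d `<=` cbox a b c d.
Proof.
move=> x /oboxP[/andP[? ?] /andP[? ?]]; apply/cboxP.
by rewrite !ltW.
Qed.

Lemma cbox_compact a b c d : compact (cbox a b c d).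
Proof. by apply: compact_setX; exact: segment_compact. Qed.

Lemma cbox_closed a b c d : closed (cbox a b c d).
Proof. by apply: compact_closed; [exact: norm_hausdorff|exact: cbox_compact]. Qed.

Lemma measurable_obox a b c d : measurable (obox a b c d).
Proof. by apply: measurableX; exact: measurable_itv. Qed.

Lemma measurable_cbox a b c d : measurable (cbox a b c d).
Proof. by apply: measurableX; exact: measurable_itv. Qed.

Lemma leb2_obox a b c d : a <= b -> c <= d ->
  leb2 (obox a b c d) = ((b - a) * (d - c))%:E.
Proof.
move=> ab cd.
transitivity (lebesgue_measure `]a, b[%classic * lebesgue_measure `]c, d[%classic)%E.
  by apply: product_measure1E; exact: measurable_itv.
rewrite !lebesgue_measure_itv/= !lte_fin EFinM.
by congr (_ * _)%E; case: ifPn => //; rewrite -leNgt => ?; congr EFin; lra.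
Qed.

Lemma leb2_cbox a b c d : a <= b -> c <= d ->
  leb2 (cbox a b c d) = ((b - a) * (d - c))%:E.
Proof.
move=> ab cd.
transitivity (lebesgue_measure `[a, b]%classic * lebesgue_measure `[c, d]%classic)%E.
  by apply: product_measure1E; exact: measurable_itv.
rewrite !lebesgue_measure_itv/= !lte_fin EFinM.
by congr (_ * _)%E; case: ifPn => //; rewrite -leNgt => ?; congr EFin; lra.
Qed.

Lemma open_boxP A x : open A -> A x ->
  exists2 e : R, 0 < e & forall y : plane R,
    `|x.1 - y.1| < e -> `|x.2 - y.2| < e -> A y.
Proof.
rewrite openE => /(_ x) oA /oA; rewrite /interior /= => /nbhs_ballP[e /= e0 H].
by exists e => // y y1 y2; apply: H; split.
Qed.

(** A triple holds the two coordinates of a rational center and a rational half-width, so there are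
    countably many boxes. The closed box leaves room for a compact support inside an open set, the
    open one serves to cover points. *)
Definition rcbox (s : rat * rat * rat) : set (plane R) :=
  cbox (ratr s.1.1 - ratr s.2) (ratr s.1.1 + ratr s.2)
       (ratr s.1.2 - ratr s.2) (ratr s.1.2 + ratr s.2).
Definition robox (s : rat * rat * rat) : set (plane R) :=
  obox (ratr s.1.1 - ratr s.2) (ratr s.1.1 + ratr s.2)
       (ratr s.1.2 - ratr s.2) (ratr s.1.2 + ratr s.2).

Lemma open_rational_box A x : open A -> A x ->
  exists s : rat * rat * rat, robox s x /\ rcbox s `<=` A.
Proof.
move=> oA Ax; have [e e0 H] := open_boxP oA Ax.
have e2 : 0 < e / 2 by rewrite divr_gt0.
have [s] := rat_in_itvoo e2; rewrite in_itv/= => /andP[s0 se].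
have [q1] : exists q : rat, ratr q \in `](x.1 - ratr s), (x.1 + ratr s)[%R.
  by apply: rat_in_itvoo; lra.
rewrite in_itv/= => /andP[q1l q1r].
have [q2] : exists q : rat, ratr q \in `](x.2 - ratr s), (x.2 + ratr s)[%R.
  by apply: rat_in_itvoo; lra.
rewrite in_itv/= => /andP[q2l q2r].
exists (q1, q2, s); split.
  by apply/oboxP => /=; split; apply/andP; split; lra.
move=> y /cboxP/= [/andP[? ?] /andP[? ?]]; apply: H; rewrite ltr_norml; apply/andP; split; lra.
Qed.

Lemma open_bigcup_rational_box A : open A ->
  A = \bigcup_s (if `[< rcbox s `<=` A >] then robox s else set0).
Proof.
move=> oA; apply/seteqP; split => x.
  move=> Ax; have [s [sx sA]] := open_rational_box oA Ax.
  by exists s => //; rewrite asboolT.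
case=> s _; case: ifPn => // /asboolP sA sx; apply: sA; exact: sub_obox_cbox.
Qed.

(** The sigma-algebra of the plane is that of the product, so openness gives measurability only
    through a countable union of boxes. *)
Lemma open_measurable2 A : open A -> measurable A.
Proof.
move=> /open_bigcup_rational_box ->; apply: countable_bigcupT_measurable => // s.
by case: ifP => _; [exact: measurable_obox|exact: measurable0].
Qed.

Lemma within_continuous_measurable2 A (f : plane R -> R) :
  {within A, continuous f} -> measurable_fun A f.
Proof.
move=> /continuousP cf mA; move: (mA).
apply: (measurability _ (RGenOpens.measurableE R)).
move=> /= _ [_ [a [b ->]] <-].
have oab : open `]a, b[%classic by exact: interval_open.
have /open_subspaceP[V oV VA] := cf _ oab.

by rewrite setIC -VA; apply: measurableI => //; exact: open_measurable2.
Qed.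

Lemma continuous_measurable2 (f : plane R -> R) : continuous f -> measurable_fun setT f.
Proof.
by move=> cf; apply: within_continuous_measurable2; apply/continuous_subspaceT.
Qed.

Lemma open_leb2_gt0 A : open A -> A !=set0 -> (0 < leb2 A)%E.
Proof.
move=> oA [x Ax]; have [e e0 H] := open_boxP oA Ax.
apply: (@lt_le_trans _ _ (leb2 (obox (x.1 - e) (x.1 + e) (x.2 - e) (x.2 + e)))).
  rewrite leb2_obox ?lte_fin; [|lra|lra].
  by apply: mulr_gt0; lra.
apply: le_measure; rewrite ?inE; [exact: measurable_obox|exact: open_measurable2|].
move=> y /oboxP[/andP[? ?] /andP[? ?]]; apply: H; rewrite ltr_norml; apply/andP; split; lra.
Qed.

(** Together with [setI_closed_obox] this gives a generating class stable under intersection, as the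
    Dynkin class argument of [fundamental_lemma_box] requires. *)
Lemma measurable_plane_obox :
  @measurable _ (plane R) = <<s [set obox r.1.1 r.1.2 r.2.1 r.2.2 | r in @setT ((R * R) * (R * R))] >>.
Proof.
set G := [set _ | _ in _].
have Gbox a b c d : <<s G >> (obox a b c d).
  by apply: sub_sigma_algebra; exists ((a, b), (c, d)).
have cup (F : nat -> set (plane R)) : (forall n, <<s G >> (F n)) -> <<s G >> (\bigcup_n F n).
  by have [_ _] := smallest_sigma_algebra setT G; apply.
rewrite eqEsubset; split; last first.
  apply: smallest_sub; first exact: sigma_algebra_measurable.
  by move=> _ [r _ <-]; exact: measurable_obox.
apply: smallest_sub; first exact: smallest_sigma_algebra.
(* The product sigma-algebra is generated by the preimages under the two projections, and these
   reduce to preimages of open intervals: strips, which are countable unions of boxes. *)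
have step (f : plane R -> measurableTypeR R) :
    (forall a b, <<s G >> (f @^-1` `]a, b[)) -> preimage_set_system setT f measurable `<=` <<s G >>.
  move=> H; rewrite [X in preimage_set_system _ _ X](_ : _ = (@RGenOpens.G R).-sigma.-measurable); last first.
    exact: RGenOpens.measurableE.
  rewrite -g_sigma_preimageE; apply: smallest_sub; first exact: smallest_sigma_algebra.
  by move=> _ [_ [a [b ->]] <-]; rewrite setTI.
rewrite subUset; split; apply: step => a b.
- rewrite (_ : _ @^-1` _ = \bigcup_n (obox a b (- n%:R) n%:R)); first exact: cup.
  apply/seteqP; split => x /=; rewrite in_itv/=.
    move=> xab; have [n xn] : exists n : nat, `|x.2| < n%:R.
      by exists (Num.truncn `|x.2|).+1; exact: truncnS_gt.
    by exists n => //; apply/oboxP; split => //; rewrite -ltr_norml.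
  by case=> n _ /oboxP[].
- rewrite (_ : _ @^-1` _ = \bigcup_n (obox (- n%:R) n%:R a b)); first exact: cup.
  apply/seteqP; split => x /=; rewrite in_itv/=.
    move=> xab; have [n xn] : exists n : nat, `|x.1| < n%:R.
      by exists (Num.truncn `|x.1|).+1; exact: truncnS_gt.
    by exists n => //; apply/oboxP; split => //; rewrite -ltr_norml.
  by case=> n _ /oboxP[].
Qed.

Lemma oboxI a b c d a' b' c' d' : obox a b c d `&` obox a' b' c' d' =
  obox (Num.max a a') (Num.min b b') (Num.max c c') (Num.min d d').
Proof.
apply/seteqP; split => x /=.
  move=> [/oboxP[/andP[? ?] /andP[? ?]] /oboxP[/andP[? ?] /andP[? ?]]].
  by apply/oboxP; rewrite !gt_max !lt_min; split; apply/andP; split; apply/andP.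
move/oboxP; rewrite !gt_max !lt_min.
move=> [/andP[/andP[? ?] /andP[? ?]] /andP[/andP[? ?] /andP[? ?]]].
by split; apply/oboxP; split; apply/andP.
Qed.

Lemma setI_closed_obox :
  setI_closed [set obox r.1.1 r.1.2 r.2.1 r.2.2 | r in @setT ((R * R) * (R * R))].
Proof. by move=> _ _ [r _ <-] [s _ <-]; rewrite oboxI /=; eexists (_,_,(_,_)). Qed.

End PlaneMeasure.

(** * Smooth bump functions *)

Section Smooth1.
Context {R : realType}.
Implicit Types (f g : R -> R) (p : {poly R}).

Fixpoint diffn (n : nat) f : Prop :=
  if n is m.+1 then (forall x, derivable f x 1) /\ diffn m (derive1 f) else True.

Definition smooth1 f := forall n, diffn n f.

Lemma smooth1_cst (c : R) : smooth1 (cst c).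
Proof.
move=> n; elim: n c => // n IH c; split; first by move=> x; exact: derivable_cst.
by rewrite (_ : derive1 _ = cst 0)//; apply/funext => x; rewrite derive1_cst.
Qed.

Lemma diffnW n f : diffn n.+1 f -> diffn n f.
Proof. by elim: n f => // n IH f [df /IH]. Qed.

Lemma diffnD n f g : diffn n f -> diffn n g -> diffn n (fun x => f x + g x).
Proof.
elim: n f g => // n IH f g [df dnf] [dg dng]; split.
  by move=> x; exact: derivableD.
rewrite (_ : derive1 _ = fun x => derive1 f x + derive1 g x); first exact: IH.
by apply/funext => x; rewrite !derive1E deriveD.
Qed.

Lemma diffnM n f g : diffn n f -> diffn n g -> diffn n (fun x => f x * g x).
Proof.
elim: n f g => // n IH f g fn gn.
have [df dnf] := fn; have [dg dng] := gn; split.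
  by move=> x; exact: derivableM.
rewrite (_ : derive1 _ = fun x => f x * derive1 g x + g x * derive1 f x).
  by apply: diffnD; apply: IH => //; exact: diffnW.
by apply/funext => x; rewrite !derive1E deriveM.
Qed.

Lemma is_derive_affine k c (x : R) : is_derive x (1 : R) (fun t : R => k * t + c) k.
Proof. by apply: is_derive_eq; rewrite addr0 /GRing.scale/= mulr1. Qed.

Lemma diffn_affine n f k c : diffn n f -> diffn n (fun x => f (k * x + c)).
Proof.
elim: n f => // n IH f [df dnf].
have H (x : R) : is_derive x (1 : R) (fun x : R => f (k * x + c)) (derive1 f (k * x + c) * k).
  apply: (@is_derive1_comp _ f); last exact: is_derive_affine.
  by rewrite derive1E; exact: derivableP.
split; first by move=> x; case: (H x).
rewrite (_ : derive1 _ = fun x => derive1 f (k * x + c) * (cst k x)).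
  apply: diffnM; first exact: IH.
  exact: smooth1_cst.
by apply/funext => x; rewrite derive1E; case: (H x).
Qed.

Lemma smooth1_derivable f x : smooth1 f -> derivable f x 1.
Proof. by move=> /(_ 1%N) []. Qed.

Lemma smooth1_continuous f : smooth1 f -> continuous f.
Proof.
by move=> sf x; apply: differentiable_continuous; apply/derivable1_diffP; exact: smooth1_derivable.
Qed.

Lemma smooth1_derive f : smooth1 f -> smooth1 (derive1 f).
Proof. by move=> sf n; case: (sf n.+1). Qed.

(* The functions p(1/x) e^(-1/x) are closed under differentiation; p = 1 gives
   the usual flat function. *)
Definition flat p (x : R) := if 0 < x then p.[x^-1] * expR (- x^-1) else 0.

Lemma flat_le0 p (x : R) : x <= 0 -> flat p x = 0.
Proof. by rewrite /flat ltNge => ->. Qed.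

Lemma flat_gt0 p (x : R) : 0 < x -> flat p x = p.[x^-1] * expR (- x^-1).
Proof. by rewrite /flat => ->. Qed.

Lemma horner_bound p : exists C : R, 0 <= C /\
  forall t, 1 <= t -> `|p.[t]| <= C * t ^+ size p.
Proof.
exists (\sum_(i < size p) `|p`_i|); split; first exact: sumr_ge0.
move=> t t1; rewrite horner_coef (le_trans (ler_norm_sum _ _ _))// mulr_suml.
apply: ler_sum => i _; rewrite normrM; apply: ler_wpM2l => //.
rewrite ger0_norm; last by rewrite exprn_ge0// (le_trans _ t1).
by apply: ler_weXn2l => //; exact: ltnW.
Qed.

(** With t = 1/x, the exponential series gives t^(size p + 2) <= (size p + 2)! e^t. The two extra
    powers of t are the square of x, which makes the difference quotient of [flat p] vanish at 0. *)
Lemma flat_bound p : exists C : R, 0 <= C /\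
  forall x, 0 < x -> x <= 1 -> `|flat p x| <= C * x ^+ 2.
Proof.
have [C [C0 HC]] := horner_bound p.
exists (C * (size p).+2`!%:R); split; first by rewrite mulr_ge0.
move=> x x0 x1; rewrite /flat x0 normrM (ger0_norm (expR_ge0 _)).
have t1 : 1 <= x^-1 by rewrite invf_ge1.
set t := x^-1 in t1 *; have t0 : 0 < t by apply: lt_le_trans t1.
apply: (@le_trans _ _ (C * t ^+ size p * expR (- t))).
  by apply: ler_wpM2r; [exact: expR_ge0|exact: HC].
rewrite -!mulrA; apply: ler_wpM2l => //.
have := expR_ge1Dxn (size p).+1 (ltW t0).
set N := _`!%:R => H; have N0 : 0 < N by rewrite ltr0n fact_gt0.
have -> : x = t^-1 by rewrite invrK.
clearbody t; rewrite exprVn expRN ler_pdivrMr ?expR_gt0// mulrAC.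
rewrite ler_pdivlMr ?exprn_gt0// -exprD addn2 mulrC -ler_pdivrMr//.
by rewrite (le_trans _ H)// lerDr.
Qed.

(** For x > 0 both p(1/x) and the exponential contribute a factor 1/x^2 from the derivative of 1/x,
    hence the polynomial (p - p') X^2. *)
Lemma is_derive_flat p (x : R) :
  is_derive x 1 (flat p) (flat ((p - p^`()) * 'X^2) x).
Proof.
have [x0|x0|->] := ltgtP x 0.
- rewrite (flat_le0 _ (ltW x0)).
  apply: (@near_eq_is_derive _ _ _ (cst (0 : R))).
  by near=> y; rewrite flat_le0// ltW//; near: y; exact: lt_nbhsl.
- rewrite (flat_gt0 _ x0).
  apply: (@near_eq_is_derive _ _ _ ((horner p \o GRing.inv) * (expR \o (fun y : R => - y^-1)))).
    near=> y; rewrite flat_gt0//; near: y; exact: lt_nbhsr.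
  have xn0 : x != 0 by rewrite gt_eqF.
  have dV : is_derive x 1 (@GRing.inv R) (- x ^- 2).
    by apply: is_derive_eq; [exact: (@is_deriveV _ id)|rewrite /GRing.scale/= mulr1].
  have d1 := is_derive1_comp (is_derive_poly p _) dV.
  have dN : is_derive x 1 (fun y : R => - y^-1) (x ^- 2).
    by apply: is_derive_eq; rewrite opprK.
  have d2 := is_derive1_comp (is_derive_expR _) dN.
  by apply: is_derive_eq; rewrite /= !hornerE /GRing.scale/=; field.
- rewrite flat_le0//.
  have [C [C0 HC]] := flat_bound p.
  suff H : (fun h : R => h^-1 *: (flat p (h *: 1 + 0) - flat p 0)) @ 0^' --> (0 : R).
    apply: DeriveDef; last exact: cvg_lim H.
    by apply/cvg_ex; exists 0.
  have C1 : 0 < C + 1 by rewrite ltr_wpDl.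
  apply/cvgr0Pnorm_le => e e0; near=> h.
  rewrite (flat_le0 _ (lexx 0)) subr0 addr0 /GRing.scale/= mulr1.
  have [h0|h0] := ltP 0 h; last by rewrite flat_le0// mulr0 normr0 ltW.
  have : `|h| <= Num.min 1 (e / (C + 1)).
    by near: h; apply: dnbhs0_le; rewrite lt_min ltr01 divr_gt0.
  rewrite le_min (gtr0_norm h0) => /andP[h1 h2].
  rewrite normrM normfV (gtr0_norm h0) ler_pdivrMl// (le_trans (HC _ h0 h1))//.
  rewrite expr2 mulrCA ler_pM2l//.
  move: h2; rewrite ler_pdivlMr// => h2; apply: le_trans h2.
  by rewrite mulrC ler_pM2l// lerDl.
Unshelve. all: by end_near. Qed.

Lemma smooth1_flat p : smooth1 (flat p).
Proof.
move=> n; elim: n p => // n IH p; split.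
  by move=> x; case: (is_derive_flat p x).
rewrite (_ : derive1 _ = flat ((p - p^`()) * 'X^2)); first exact: IH.
by apply/funext => x; rewrite derive1E; case: (is_derive_flat p x).
Qed.


(** One flat factor vanishes left of a, the other right of b. Since the flat function tends to 1 at
    infinity, the dilation by n + 1 makes the bumps tend pointwise to the indicator function of ]a,
    b[. *)
Definition bump (a b : R) (n : nat) (x : R) : R :=
  flat 1 (n.+1%:R * x + n.+1%:R * - a) * flat 1 (- n.+1%:R * x + n.+1%:R * b).

Lemma smooth1_bump a b n : smooth1 (bump a b n).
Proof. by move=> m; apply: diffnM; apply: diffn_affine; exact: smooth1_flat. Qed.

Lemma flat1_ge0 (x : R) : 0 <= flat 1 x.
Proof. by rewrite /flat; case: ifP => // _; rewrite hornerE mul1r expR_ge0. Qed.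

Lemma flat1_le1 (x : R) : flat 1 x <= 1.
Proof.
rewrite /flat; case: ifP => // x0; rewrite hornerE mul1r expR_le1 oppr_le0 invr_ge0.
exact: ltW.
Qed.

Lemma bump_ge0 a b n x : 0 <= bump a b n x.
Proof. by apply: mulr_ge0; exact: flat1_ge0. Qed.

Lemma bump_le1 a b n x : bump a b n x <= 1.
Proof. by rewrite -[leRHS]mulr1 ler_pM ?flat1_ge0 ?flat1_le1. Qed.

Lemma bump_notin a b n x : ~~ (a < x < b) -> bump a b n x = 0.
Proof.
rewrite negb_and -!leNgt /bump => /orP[xa|bx].
  rewrite flat_le0 ?mul0r// -mulrDr pmulr_rle0// subr_le0//.
rewrite [X in _ * X]flat_le0 ?mulr0// mulNr -mulrN -mulrDr pmulr_rle0//.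
by rewrite addrC subr_le0.
Qed.

Lemma cvg_flat1 (x : R) : 0 < x -> flat 1 (n.+1%:R * x) @[n --> \oo] --> (1 : R).
Proof.
move=> x0.
rewrite (_ : (fun n => _) = fun n => expR (- (n.+1%:R^-1 * x^-1))); last first.
  by apply/funext => n; rewrite flat_gt0 ?mulr_gt0// hornerE mul1r invfM.
rewrite -[X in _ --> X](@expR0 R); apply: continuous_cvg; first exact: continuous_expR.
rewrite -oppr0 -[X in - X](mul0r x^-1).
by apply: cvgN; apply: cvgM; [exact: cvg_harmonic|exact: cvg_cst].
Qed.

Lemma cvg_bump a b x : bump a b n x @[n --> \oo] --> ((a < x < b)%R%:R : R).
Proof.
have [/andP[ax xb]|/negP xab] := boolP (a < x < b); last first.
  rewrite (_ : (fun n => _) = cst 0); first exact: cvg_cst.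
  by apply/funext => n; rewrite bump_notin//; apply/negP.
rewrite -[X in _ --> X]mulr1 /bump; apply: cvgM.
  under eq_fun do rewrite -mulrDr.
  by apply: cvg_flat1; rewrite subr_gt0.
under eq_fun do rewrite mulNr -mulrN -mulrDr.
by apply: cvg_flat1; rewrite addrC subr_gt0.
Qed.

End Smooth1.

(** * Square integrable functions *)

Section L2.
Context {R : realType}.
Local Notation mu := (@leb2 R).
Implicit Types (Omega : set (plane R)) (f g h : plane R -> R).

(** [L2] speaks of the extension by zero to the plane; this is the form on [Omega] in which
    integrals are computed. *)
Lemma L2P Omega f : measurable Omega ->
  L2 Omega f <-> measurable_fun Omega f /\ mu.-integrable Omega (EFin \o (fun x => f x ^+ 2)).
Proof.
move=> mO; rewrite /L2; split.
  move=> /[dup] /Lfun2_integrable_sqr h; rewrite inE => /andP[+ _].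
  rewrite inE/= => /(measurable_restrictT _ mO) mf; split => //.
  have -> : EFin \o (fun x => f x ^+ 2) = fun x => (f x ^+ 2)%:E by [].
  apply/(integrable_mkcond _ mO).
  apply: eq_integrable h => //= x _.
  by rewrite /patch/=; case: ifP => //; rewrite expr0n.
move=> [mf fi]; rewrite inE; apply/andP; split; rewrite inE/=.
  exact/(measurable_restrictT _ mO).
rewrite /finite_norm unlock /Lnorm poweR_lty//.
have /integrableP[_] := (integrable_mkcond _ mO).1 fi.
apply: le_lt_trans; rewrite le_eqVlt; apply/orP; left; apply/eqP.
apply: eq_integral => x _ /=; rewrite powR_mulrn// real_normK ?num_real//.
by rewrite /patch; case: ifP => _ /=; rewrite ?expr0n//= ger0_norm ?sqr_ge0.
Qed.

Lemma L2D Omega f g : L2 Omega f -> L2 Omega g -> L2 Omega (fun x => f x + g x).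
Proof.
rewrite /L2 => fL gL.
rewrite (_ : _ \_ _ = f \_ Omega + g \_ Omega); last first.
  by apply/funext => x; rewrite !fctE /patch; case: ifP => // _; rewrite addr0.
by have [_] := @Lfun_addr_closed _ _ _ mu _ (lee1n 2); apply.
Qed.

Lemma L2Z Omega f a : L2 Omega f -> L2 Omega (fun x => a * f x).
Proof.
rewrite /L2 => fL.
rewrite (_ : _ \_ _ = a \o* f \_ Omega); last first.
  by apply/funext => x; rewrite /= /patch mulrC; case: ifP => // _; rewrite mul0r.
by apply: Lfun_scale => //; rewrite ler1n.
Qed.

Lemma L2N Omega f : L2 Omega f -> L2 Omega (fun x => - f x).
Proof. by move=> /(@L2Z _ _ (-1)); congr L2; apply/funext => x; rewrite mulN1r. Qed.

Lemma L2B Omega f g : L2 Omega f -> L2 Omega g -> L2 Omega (fun x => f x - g x).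
Proof. by move=> fL /L2N; exact: L2D. Qed.

Lemma L2_mul Omega f g : measurable Omega -> L2 Omega f -> L2 Omega g ->
  mu.-integrable Omega (EFin \o (fun x => f x * g x)).
Proof.
move=> mO fL gL; have /Lfun1_integrable := Lfun2_mul_Lfun1 fL gL.
move=> h; apply/(integrable_mkcond _ mO).
apply: eq_integrable h => //= x _.
by rewrite /patch/=; case: ifP => //; rewrite mulr0.
Qed.

Lemma eq_restrict Omega f g : (forall x, Omega x -> f x = g x) ->
  f \_ Omega = g \_ Omega.
Proof.
by move=> fg; apply/funext => x; rewrite /patch; case: ifPn => // /[1!inE] /fg.
Qed.

Lemma L2_ext Omega f g : (forall x, Omega x -> f x = g x) -> L2 Omega f -> L2 Omega g.
Proof. by move=> /eq_restrict fg; rewrite /L2 fg. Qed.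

Lemma normL_ext Omega p f g : (forall x, Omega x -> f x = g x) ->
  normL Omega p f = normL Omega p g.
Proof. by move=> /eq_restrict fg; rewrite /normL fg. Qed.

Lemma L2_normL_fin Omega f : L2 Omega f -> normL Omega 2 f \is a fin_num.
Proof.
rewrite /L2 inE => /andP[_]; rewrite inE/= /finite_norm => h.
by rewrite ge0_fin_numE ?Lnorm_ge0.
Qed.

Lemma sqr_normL Omega f : measurable Omega -> L2 Omega f ->
  fine (normL Omega 2 f) ^+ 2 = \int[mu]_(x in Omega) (f x ^+ 2).
Proof.
move=> mO fL; have fin := L2_normL_fin fL.
have : (normL Omega 2 f `^ 2 = \int[mu]_x (((f \_ Omega) x ^+ 2)%:E))%E.
  rewrite /normL poweR_Lnorm//; apply: eq_integral => x _ /=.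
  by rewrite powR_mulrn// real_normK ?num_real.
rewrite -(fineK fin) /= powR_mulrn ?fine_ge0 ?Lnorm_ge0// => h.
rewrite Rintegral_mkcond /Rintegral -[LHS]/(fine (_%:E)) h.
congr fine; apply: eq_integral => x _ /=.
by rewrite /patch; case: ifP => //; rewrite expr0n.
Qed.

Lemma L2_CauchySchwarz Omega f g : measurable Omega -> L2 Omega f -> L2 Omega g ->
  `|\int[mu]_(x in Omega) (f x * g x)| <= fine (normL Omega 2 f) * fine (normL Omega 2 g).
Proof.
move=> mO fL gL.
have fin : forall u, L2 Omega u -> normL Omega 2 u \is a fin_num by move=> u; exact: L2_normL_fin.
have mfL : forall u, L2 Omega u -> measurable_fun setT (u \_ Omega).
  by move=> u; rewrite /L2 inE => /andP[]; rewrite inE.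
apply: le_trans (le_normr_Rintegral mO (L2_mul mO fL gL)) _.
rewrite -lee_fin EFinM !fineK ?fin//.
have := @hoelder _ _ _ mu _ _ 2 2 (mfL _ fL) (mfL _ gL) _ _ _; rewrite Lnorm1.
move=> /(_ (ltr0Sn _ _) (ltr0Sn _ _)); rewrite -/(normL _ _ _) -/(normL _ _ _).
have e2 : 2^-1 + 2^-1 = 1 :> R by rewrite [RHS]splitr !div1r.
move=> /(_ e2); apply: le_trans.
  rewrite integral_mkcond le_eqVlt; apply/orP; left; apply/eqP; apply: eq_integral => x _ /=.
  by rewrite /patch; case: ifP => //; rewrite mulr0 normr0.
by apply: integrable_fin_num => //; exact: integrable_norm (L2_mul mO fL gL).
Qed.

(** Strong convergence implies weak convergence, by Cauchy-Schwarz. Integral identities for test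
    functions pass to their limits in this way. *)
Lemma L2_cvg_int Omega (psi : nat -> plane R -> R) f h : measurable Omega ->
  (forall n, L2 Omega (psi n)) -> L2 Omega f -> L2 Omega h ->
  (fun n => normL Omega 2 (psi n \- f)) @ \oo --> 0%E ->
  (\int[mu]_(x in Omega) (psi n x * h x)) @[n --> \oo] -->
   \int[mu]_(x in Omega) (f x * h x).
Proof.
move=> mO psiL fL hL cv.
have dL n : L2 Omega (psi n \- f) by exact: L2B.
have : (fun n => fine (normL Omega 2 (psi n \- f))) @ \oo --> 0.
  by have /fine_cvgP[] := cv.
move=> cvf; apply/subr_cvg0/norm_cvg0P.
apply: (@squeeze_cvgr _ _ _ _ (cst 0) (fun n => fine (normL Omega 2 (psi n \- f)) * fine (normL Omega 2 h))); last 2 first.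
- exact: cvg_cst.
- by rewrite -[X in _ --> X](mul0r (fine (normL Omega 2 h))); apply: cvgM => //; exact: cvg_cst.
near=> n; rewrite normr_ge0/= -RintegralB//; [|exact: L2_mul|exact: L2_mul].
under eq_Rintegral do rewrite -mulrBl.
exact: (L2_CauchySchwarz mO (dL n) hL).
Unshelve. all: by end_near. Qed.

Lemma L2_bounded Omega f C : measurable Omega -> (mu Omega < +oo)%E ->
  measurable_fun Omega f -> (forall x, Omega x -> `|f x| <= C) -> L2 Omega f.
Proof.
move=> mO fO mf fC; apply/(L2P _ mO); split => //.
apply: measurable_bounded_integrable => //; first exact: measurable_funX.
exists (C ^+ 2); split; first exact: num_real.
move=> y Cy x Ox; apply: le_trans (ltW Cy) => /=.
by rewrite normrX lerXn2r ?nnegrE ?fC// (le_trans _ (fC x Ox)).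
Qed.

End L2.

(** * Test functions *)

Section TestFunctions.
Context {R : realType}.
Local Notation mu := (@leb2 R).
Implicit Types (Omega S : set (plane R)) (f g psi chi F : plane R -> R).

Definition crd (i : bool) (x : plane R) : R := if i then x.2 else x.1.

(** The restriction of F to the line through x in direction [e_ i], parametrized by the moving
    coordinate, so that partial derivatives become derivatives in one variable. *)
Definition slice (i : bool) F (x : plane R) : R -> R :=
  fun s => if i then F (x.1, s) else F (s, x.2).

Lemma slice_growth i F x (h : R) : F (h *: e_ i + x) = slice i F x (h *: 1 + crd i x).
Proof.
case: x => x1 x2; case: i; rewrite /slice /crd /e_ /=; congr F;
  by congr pair; rewrite /= /GRing.scale/= ?mulr0 ?add0r.
Qed.

Lemma derivable_slice i F x : derivable F x (e_ i) <-> derivable (slice i F x) (crd i x) 1.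
Proof.
rewrite /derivable (_ : F x = slice i F x (crd i x)); last first.
  by have := slice_growth i F x 0; rewrite !scale0r !add0r.
by under eq_fun do rewrite /= slice_growth.
Qed.

Lemma derive_slice i F x : 'D_(e_ i) F x = derive1 (slice i F x) (crd i x).
Proof.
rewrite derive1E /derive (_ : F x = slice i F x (crd i x)); last first.
  by have := slice_growth i F x 0; rewrite !scale0r !add0r.
by under eq_fun do rewrite /= slice_growth.
Qed.

Definition tensor (f g : R -> R) : plane R -> R := fun x => f x.1 * g x.2.

Lemma derivable_tensor i (f g : R -> R) x : smooth1 f -> smooth1 g ->
  derivable (tensor f g) x (e_ i).
Proof.
move=> sf sg; apply/derivable_slice; rewrite /slice /tensor; case: i => /=.
  by apply: derivableM; [exact: derivable_cst|exact: smooth1_derivable].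
by apply: derivableM; [exact: smooth1_derivable|exact: derivable_cst].
Qed.

Lemma derive_tensor i (f g : R -> R) x : smooth1 f -> smooth1 g ->
  'D_(e_ i) (tensor f g) x =
  (if i then tensor f (derive1 g) else tensor (derive1 f) g) x.
Proof.
move=> sf sg; rewrite derive_slice /slice /tensor; case: i => /=.
  by rewrite derive1Ml//; exact: smooth1_derivable.
by rewrite derive1Mr//; exact: smooth1_derivable.
Qed.

Lemma continuous_tensor (f g : R -> R) : continuous f -> continuous g ->
  continuous (tensor f g).
Proof.
move=> cf cg x; apply: (@cvgM _ _ _ _ (f \o fst) (g \o snd)).
  by apply: (@continuous_comp _ _ _ fst f); [exact: continuous_fst2|exact: cf].
by apply: (@continuous_comp _ _ _ snd g); [exact: continuous_snd2|exact: cg].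
Qed.

Lemma smooth_tensor (f g : R -> R) : smooth1 f -> smooth1 g -> smooth (tensor f g).
Proof.
move=> sf sg s; have [f' [g' [sf' sg' ->]]] :
    exists f' g' : R -> R, [/\ smooth1 f', smooth1 g' & iter_partial s (tensor f g) = tensor f' g'].
  elim: s => [|i s [f' [g' [sf' sg' IH]]]]; first by exists f, g.
  rewrite /= IH.
  exists (if i then f' else derive1 f'), (if i then derive1 g' else g').
  by split; case: (i) => //; try exact: smooth1_derive; apply/funext => x;
    rewrite derive_tensor.
by split; [apply: continuous_tensor; exact: smooth1_continuous|move=> i x; exact: derivable_tensor].
Qed.

Lemma closed_support_subset F S : closed S -> (forall x, ~ S x -> F x = 0) ->
  closed_support F `<=` S.
Proof.
move=> cS FS; rewrite /closed_support [X in _ `<=` X](closure_id S).1//.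
apply: closure_subset => x /= Fx; apply: contrapT => /FS Fx0.
by rewrite Fx0 eqxx in Fx.
Qed.

Lemma test_function_bump Omega a b c d n : cbox a b c d `<=` Omega ->
  test_function Omega (tensor (bump a b n) (bump c d n)).
Proof.
move=> BO.
have sB : closed_support (tensor (bump a b n) (bump c d n)) `<=` cbox a b c d.
  apply: closed_support_subset; first exact: cbox_closed.
  move=> x; apply: contra_notP => /eqP; rewrite mulf_eq0 negb_or => /andP[h1 h2].
  apply: sub_obox_cbox; apply/oboxP; split.
    by apply: contraNT h1 => /bump_notin ->.
  by apply: contraNT h2 => /bump_notin ->.
split; last exact: subset_trans sB BO.
  by apply: smooth_tensor; exact: smooth1_bump.
by apply: subclosed_compact sB; [exact: closed_closure|exact: cbox_compact].
Qed.

Lemma compact_sub_cbox S : compact S -> exists2 N : R, 0 < N & S `<=` cbox (- N) N (- N) N.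
Proof.
move=> /compact_bounded[M [_ HM]]; exists (`|M| + 1); first by rewrite ltr_pwDr.
move=> x Sx; have : `|x| <= `|M| + 1 by apply: HM => //; rewrite ltr_pwDr// ler_norm.
by rewrite prod_normE ge_max => /andP[h1 h2]; apply/cboxP; rewrite -!ler_norml.
Qed.

Section CompactSupport.
Variables (F : plane R -> R) (S : set (plane R)).
Hypotheses (cF : continuous F) (cS : compact S) (FS : forall x, ~ S x -> F x = 0).

Lemma compact_support_bounded : exists C, forall x, `|F x| <= C.
Proof.
have [M [_ HM]] : bounded_set (F @` S).
  by apply: compact_bounded; apply: continuous_compact => //; exact: continuous_subspaceT.
exists (`|M| + 1) => x; have [Sx|/FS ->] := pselect (S x); last by rewrite normr0.
by apply: HM; [rewrite ltr_pwDr// ler_norm|exists x].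
Qed.

Lemma compact_support_integrable : mu.-integrable setT (EFin \o F).
Proof.
have [N N0 SN] := compact_sub_cbox cS.
have [C HC] := compact_support_bounded.
have mB : measurable (cbox (- N) N (- N) N) by exact: measurable_cbox.
have : mu.-integrable (cbox (- N) N (- N) N) (EFin \o F).
  apply: measurable_bounded_integrable => //.
  - by rewrite leb2_cbox ?ltry//; lra.
  - by apply: measurable_funTS; exact: continuous_measurable2.
  exists C; split; first exact: num_real.
  by move=> y Cy x _ /=; apply: le_trans (HC _) (ltW Cy).
move=> /(integrable_mkcond _ mB); apply: eq_integrable => //= x _.
rewrite /patch; case: ifPn => // xB; rewrite /= FS// => /SN xS; case/negP: xB; exact: mem_set.
Qed.

End CompactSupport.

Lemma compact_support_L2 Omega F S : measurable Omega -> continuous F -> compact S ->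
  (forall x, ~ S x -> F x = 0) -> L2 Omega F.
Proof.
move=> mO cF cS FS; apply/(L2P _ mO); split.
  by apply: measurable_funTS; exact: continuous_measurable2.
apply: (@integrableS _ _ _ mu setT) => //.
apply: (@compact_support_integrable _ S) => //; last by move=> x /FS ->; rewrite expr0n.
by move=> x; under eq_fun do rewrite expr2; apply: cvgM; exact: cF.
Qed.

Lemma test_function_continuous Omega psi : test_function Omega psi -> continuous psi.
Proof. by case=> /(_ [::]) []. Qed.

Lemma test_function_derivable Omega psi i x : test_function Omega psi ->
  derivable psi x (e_ i).
Proof. by case=> /(_ [::]) [_ +] _ _; apply. Qed.

Lemma test_function_derive_continuous Omega psi i : test_function Omega psi ->
  continuous ('D_(e_ i) psi).
Proof. by case=> /(_ [:: i]) []. Qed.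

Lemma closed_supportN F x : ~ closed_support F x -> F x = 0.
Proof.
by move=> H; apply: contrapT => /eqP Fx; apply: H; exact: subset_closure.
Qed.

Lemma derive_closed_supportN i F x : ~ closed_support F x -> 'D_(e_ i) F x = 0.
Proof.
move=> H; rewrite (@near_eq_derive _ _ _ _ (cst 0)) ?derive_cst//.
have : open (~` closed_support F) by apply: closed_openC; exact: closed_closure.
rewrite openE => /(_ x H); rewrite /interior/=; apply: filterS => y.
exact: closed_supportN.
Qed.

Lemma test_function_L2 Omega D psi : measurable D -> test_function Omega psi -> L2 D psi.
Proof.
move=> mD tp; have [_ cp _] := tp; apply: (compact_support_L2 mD _ cp).
  exact: test_function_continuous tp.
by move=> x; exact: closed_supportN.
Qed.

Lemma test_function_derive_L2 Omega D psi i : measurable D -> test_function Omega psi ->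
  L2 D ('D_(e_ i) psi).
Proof.
move=> mD tp; have [_ cp _] := tp; apply: (compact_support_L2 mD _ cp).
  exact: test_function_derive_continuous tp.
by move=> x; exact: derive_closed_supportN.
Qed.

End TestFunctions.

(** * The fundamental lemma of the calculus of variations *)

Section FundamentalLemma.
Context {R : realType}.
Local Notation mu := (@leb2 R).
Implicit Types (Omega : set (plane R)) (f g psi chi F : plane R -> R).

Lemma L2_sub Omega D f : measurable Omega -> measurable D -> D `<=` Omega ->
  L2 Omega f -> L2 D f.
Proof.
move=> mO mD DO /(L2P _ mO) [mf fi]; apply/(L2P _ mD); split.
  exact: measurable_funS mf.
exact: integrableS fi.
Qed.

Lemma leb2_cbox_lty (a b c d : R) : (mu (cbox a b c d) < +oo)%E.
Proof.
have [ab|ab] := leP a b; last first.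
  rewrite (_ : cbox _ _ _ _ = set0) ?measure0 ?ltry//.
  by apply/seteqP; split => x // /cboxP[/andP[? ?] _]; exfalso; lra.
have [cd|cd] := leP c d; last first.
  rewrite (_ : cbox _ _ _ _ = set0) ?measure0 ?ltry//.
  by apply/seteqP; split => x // /cboxP[_ /andP[? ?]]; exfalso; lra.
by rewrite leb2_cbox// ltry.
Qed.

Lemma L2_integrable_cbox Omega f a b c d : measurable Omega -> cbox a b c d `<=` Omega ->
  L2 Omega f -> mu.-integrable (cbox a b c d) (EFin \o f).
Proof.
move=> mO BO fL; have mB := measurable_cbox a b c d.
have /(L2_mul mB) := L2_sub mO mB BO fL.
have L1 : L2 (cbox a b c d) (cst (1:R)).
  apply: (@L2_bounded _ _ _ 1) => //; first exact: leb2_cbox_lty.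
  by move=> x _ /=; rewrite normr1.
by move=> /(_ _ L1); apply: eq_integrable => // x _ /=; rewrite mulr1.
Qed.

(* Test against smooth bumps converging to the indicator function of the box. *)
Lemma integral_obox_eq0 Omega f a b c d : measurable Omega -> L2 Omega f ->
  (forall psi, test_function Omega psi -> \int[mu]_(x in Omega) (f x * psi x) = 0) ->
  cbox a b c d `<=` Omega -> (\int[mu]_(x in obox a b c d) (f x)%:E = 0)%E.
Proof.
move=> mO fL H BO.
have mB := measurable_cbox a b c d.
have fB := L2_integrable_cbox mO BO fL.
pose ps n := tensor (bump a b n) (bump c d n).
have mps n : measurable_fun setT (ps n).
  by apply: continuous_measurable2; apply: continuous_tensor;
    apply: smooth1_continuous; exact: smooth1_bump.
have ps0 n x : ~ obox a b c d x -> ps n x = 0.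
  move=> xB; apply: contrapT => /eqP; rewrite mulf_eq0 negb_or => /andP[h1 h2].
  apply: xB; apply/oboxP; split.
    by apply: contraNT h1 => /bump_notin ->.
  by apply: contraNT h2 => /bump_notin ->.
have ps1 n x : `|ps n x| <= 1.
  rewrite /ps /tensor normrM !ger0_norm ?bump_ge0// -[leRHS]mulr1.
  by rewrite ler_pM ?bump_ge0 ?bump_le1.
have mf : measurable_fun (cbox a b c d) f by apply/measurable_EFinP; case/integrableP: fB.
pose h x := f x * (\1_(obox a b c d) x : R).
have mh : measurable_fun (cbox a b c d) h.
  by apply: measurable_funM => //; apply: measurable_funTS; exact: measurable_indic (measurable_obox _ _ _ _).
(* The bumps are bounded by 1, so |f|, integrable on the closed box, dominates. *)
have [] := @dominated_convergence _ _ _ mu _ mB (fun n x => (f x * ps n x)%:E)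
  (fun x => (h x)%:E) (fun x => `|(f x)%:E|%E).
- by move=> n; apply/measurable_EFinP; apply: measurable_funM => //; exact: measurable_funTS.
- exact/measurable_EFinP.
- apply/aeW => x _; apply: cvg_EFin; first exact: nearW.
  rewrite /=; apply: cvgM; first exact: cvg_cst.
  rewrite indicE; have -> : (x \in obox a b c d)%:R = ((a < x.1 < b)%R%:R * (c < x.2 < d)%R%:R) :> R.
    rewrite -natrM mulnb; congr (_%:R); congr nat_of_bool.
    by apply/idP/andP; [rewrite inE => /oboxP|rewrite inE => ?; apply/oboxP].
  by apply: cvgM; exact: cvg_bump.
- exact: integrable_abse.
- by apply/aeW => x n _; rewrite /= normrM lee_fin ler_piMr.
move=> _ _ cvI.
have E0 n : (\int[mu]_(x in cbox a b c d) (f x * ps n x)%:E = 0)%E.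
  have tp : test_function Omega (ps n) by exact: test_function_bump.
  have := H _ tp; rewrite Rintegral_mkcond (_ : _ \_ _ = (fun x => f x * ps n x) \_ (cbox a b c d)); last first.
    apply/funext => x; rewrite /patch.
    have [xB|xB] := pselect (cbox a b c d x); first by rewrite !mem_set//; exact: BO.
    by rewrite [X in _ = (if X then _ else _)]memNset// ps0 ?mulr0 ?if_same// => /sub_obox_cbox.
  (* [fine] sends the infinite values to 0 as well, so the vanishing of the real integral says
     something about the extended one only once the latter is known to be finite. *)
  rewrite -Rintegral_mkcond /Rintegral => /eqP; rewrite fine_eq0; first by move/eqP.
  apply: integrable_fin_num => //; apply: (L2_mul mB); first exact: L2_sub mO mB BO fL.
  exact: test_function_L2 tp.
have : (\int[mu]_(x in cbox a b c d) (h x)%:E = 0)%E.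
  have := cvg_lim (@ereal_hausdorff R) cvI => <-.
  rewrite (_ : (fun _ => _) = cst 0%E); first exact: lim_cst.
  by apply/funext => n; exact: E0.
rewrite integral_mkcond => <-; rewrite [LHS]integral_mkcond; apply: eq_integral => x _.
rewrite /patch /h indicE; have [xB|xB] := boolP (x \in obox a b c d).
  by rewrite mem_set ?mulr1//; apply: sub_obox_cbox; rewrite inE in xB.
by rewrite mulr0; case: ifP.
Qed.

(** The sets over which the zero extension F integrates to 0 form a Dynkin class containing the open
    boxes, hence contain all measurable sets, which forces F = 0 almost everywhere. *)
Lemma fundamental_lemma_box Omega f a b c d : measurable Omega -> L2 Omega f ->
  (forall psi, test_function Omega psi -> \int[mu]_(x in Omega) (f x * psi x) = 0) ->
  cbox a b c d `<=` Omega -> {ae mu, forall x, obox a b c d x -> f x = 0}.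
Proof.
move=> mO fL H BO.
have mB := measurable_obox a b c d.
have fB : mu.-integrable (obox a b c d) (EFin \o f).
  apply: integrableS (L2_integrable_cbox mO BO fL) => //; [exact: measurable_cbox|exact: sub_obox_cbox].
pose F := (EFin \o f) \_ (obox a b c d).
have iF : mu.-integrable setT F by apply/(integrable_mkcond _ mB).
have iFS S : measurable S -> mu.-integrable S F by move=> mS; exact: integrableS iF.
suff : forall S, measurable S -> (\int[mu]_(x in S) F x = 0)%E.
  move=> S0; have : ae_eq mu setT F (cst 0%E).
    apply: integral_ae_eq => // E _ mE; rewrite S0//.
    by rewrite integral_cst//= mul0e.
  apply: filterS => x /(_ I); rewrite /F /patch => + Bx.
  by rewrite mem_set//= => -[].
move=> S; rewrite measurable_plane_obox.
apply: (@dynkin_induction _ _ _ (fun S => \int[mu]_(x in S) F x = 0)%E measurable_plane_obox setI_closed_obox).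
- by rewrite -integral_mkcond; exact: (integral_obox_eq0 mO fL H BO).
- move=> _ [r _ <-]; rewrite -integral_mkcondr oboxI.
  apply: (integral_obox_eq0 mO fL H) => x /cboxP.
  rewrite !ge_max !le_min => -[/andP[/andP[? ?] /andP[? ?]] /andP[/andP[? ?] /andP[? ?]]].
  by apply: BO; apply/cboxP; split; apply/andP.
- move=> T mT T0; have : (\int[mu]_(x in setT) F x = 0)%E.
    by rewrite -integral_mkcond; exact: (integral_obox_eq0 mO fL H BO).
  rewrite -(setvU T) integral_setU//; first by rewrite T0 adde0.
  - exact: measurableC.
  - by rewrite setvU; case/integrableP: iF.
  - by apply/disj_setPS; rewrite setICl.
- move=> T mT tT T0; rewrite integral_bigcup//; first by rewrite eseries0.
  by apply: iFS; exact: bigcupT_measurable.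
Qed.

Lemma fundamental_lemma Omega f : open Omega -> L2 Omega f ->
  (forall psi, test_function Omega psi -> \int[mu]_(x in Omega) (f x * psi x) = 0) ->
  {ae mu, forall x, Omega x -> f x = 0}.
Proof.
move=> oO fL H; have mO := open_measurable2 oO.
(* Enumerating the rational boxes by [unpickle] gathers their exceptional null sets into a single
   one. *)
have : {ae mu, forall x (n : nat), forall s, unpickle n = Some s ->
    rcbox s `<=` Omega -> robox s x -> f x = 0}.
  apply/ae_foralln => n; case: unpickle => [s|]; last by apply: aeW.
  have [sO|sO] := pselect (@rcbox R s `<=` Omega).
    by apply: filterS (fundamental_lemma_box mO fL H sO) => x fx _ [<-].
  by apply: aeW => x _ [<-].
apply: filterS => x Hx Ox; have [s [sx sO]] := open_rational_box oO Ox.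
exact: (Hx (pickle s) s (pickleK s)).
Qed.

End FundamentalLemma.

(** * Integration by parts *)

Section IntegrationByParts.
Context {R : realType}.
Local Notation mu := (@leb2 R).
Implicit Types (Omega S : set (plane R)) (f g psi chi F : plane R -> R).

Lemma integral_derive1_eq0 (g : R -> R) (N : R) : 0 < N ->
  (forall x, derivable g x 1) -> continuous (derive1 g) ->
  (forall x, N < `|x| -> g x = 0) ->
  (\int[lebesgue_measure]_x (derive1 g x)%:E = 0)%E.
Proof.
move=> N0 dg cg gN.
have cg0 : continuous g.
  by move=> x; apply: differentiable_continuous; apply/derivable1_diffP.
have g'N x : N < `|x| -> derive1 g x = 0.
  move=> Nx; rewrite derive1E (@near_eq_derive _ _ _ _ (cst 0)) ?derive_cst ?oner_neq0//.
  near=> y; apply: gN; near: y.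
  have : `|y| @[y --> x] --> `|x| by apply: norm_continuous.
  by move=> /cvgr_gt; apply.
(* The hypothesis is silent at |x| = N; at distance N + 1 both boundary values vanish. *)
pose b := N + 1; have b0 : - b < b by rewrite /b; lra.
rewrite (_ : \int[_]_x _ = \int[lebesgue_measure]_(x in `[(- b)%R, b%R]) (derive1 g x)%:E)%E; last first.
  rewrite [RHS]integral_mkcond; apply: eq_integral => x _.
  rewrite /patch; case: ifPn => // xb; rewrite g'N// ltNge; apply: contra xb => xN.
  rewrite inE/= in_itv/= -ler_norml (le_trans xN)// /b; lra.
rewrite (@continuous_FTC2 _ (derive1 g) g _ _ b0).
- by rewrite !gN ?subee// ?normrN ger0_norm /b; lra.
- exact: continuous_subspaceT.
- split => [x _//||]; [apply: cvg_at_right_filter|apply: cvg_at_left_filter]; exact: cg0.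
Unshelve. all: by end_near. Qed.

Lemma slice_crd i F (x : plane R) s : slice i F x s = F (if i then (x.1, s) else (s, x.2)).
Proof. by case: i. Qed.

(** Fubini with the inner integral along [e_ i]: on each line the derivative of a compactly
    supported function integrates to 0. The order of integration therefore depends on [i]. *)
Lemma integral_derive_eq0 i F S : (forall x, derivable F x (e_ i)) ->
  continuous ('D_(e_ i) F) -> compact S -> (forall x, ~ S x -> F x = 0) ->
  (\int[mu]_x ('D_(e_ i) F x)%:E = 0)%E.
Proof.
move=> dF cdF cS FS.
have clS : closed S by apply: compact_closed => //; exact: norm_hausdorff.
have dFS x : ~ S x -> 'D_(e_ i) F x = 0.
  by move=> Sx; apply: derive_closed_supportN => /(closed_support_subset clS FS).
have iF : mu.-integrable setT (EFin \o 'D_(e_ i) F) by exact: compact_support_integrable cS dFS.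
have [N N0 SN] := compact_sub_cbox cS.
have zeroslice (x : plane R) : (\int[lebesgue_measure]_s (derive1 (slice i F x) s)%:E = 0)%E.
  have crdE s : crd i (if i then (x.1, s) else (s, x.2)) = s by case: (i).
  have sliceE s : slice i F (if i then (x.1, s) else (s, x.2)) = slice i F x.
    by apply/funext => t; rewrite /slice; case: (i).
  apply: (@integral_derive1_eq0 (slice i F x) N) => //.
  - move=> s; have /derivable_slice := dF (if i then (x.1, s) else (s, x.2)).
    by rewrite crdE sliceE.
  - have -> : derive1 (slice i F x) = 'D_(e_ i) F \o (fun s : R => (if i then (x.1, s) else (s, x.2)) : plane R).
      by apply/funext => s; rewrite /= derive_slice crdE sliceE.
    move=> s; apply: continuous_comp; last exact: cdF.
    by case: (i); [apply: (cvg_pair (cvg_cst _) cvg_id)|apply: (cvg_pair cvg_id (cvg_cst _))].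
  - move=> s Ns; rewrite slice_crd FS// => /SN /cboxP; case: (i) => /= -[].
      by move=> _; rewrite -ler_norml leNgt Ns.
    by rewrite -ler_norml leNgt Ns.
case: i dF cdF dFS iF zeroslice => dF cdF dFS iF zeroslice.
  rewrite -[LHS](integral12_prod_meas1 iF).
  apply: integral0_eq => x1 _; rewrite /fubini_F -[RHS](zeroslice (x1, 0)).
  by apply: eq_integral => x2 _; rewrite -[LHS]/(('D_(e_ true) F (x1, x2))%:E) derive_slice.
rewrite -[LHS](integral21_prod_meas1 iF).
apply: integral0_eq => x2 _; rewrite /fubini_G -[RHS](zeroslice (0, x2)).
by apply: eq_integral => x1 _; rewrite -[LHS]/(('D_(e_ false) F (x1, x2))%:E) derive_slice.
Qed.

Lemma integration_by_parts2 i psi chi : test_function setT psi -> test_function setT chi ->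
  \int[mu]_x (psi x * 'D_(e_ i) chi x) = - \int[mu]_x ('D_(e_ i) psi x * chi x).
Proof.
move=> tp tc.
have dp x := @test_function_derivable _ _ _ i x tp.
have dc x := @test_function_derivable _ _ _ i x tc.
have DE x : 'D_(e_ i) (psi \* chi) x = psi x * 'D_(e_ i) chi x + 'D_(e_ i) psi x * chi x.
  by rewrite deriveM// /GRing.scale/= [chi x * _]mulrC.
have I1 : mu.-integrable setT (EFin \o (fun x => psi x * 'D_(e_ i) chi x)).
  by apply: L2_mul => //; [exact: test_function_L2 tp|exact: test_function_derive_L2 tc].
have I2 : mu.-integrable setT (EFin \o (fun x => 'D_(e_ i) psi x * chi x)).
  by apply: L2_mul => //; [exact: test_function_derive_L2 tp|exact: test_function_L2 tc].
apply/eqP; rewrite -addr_eq0 -RintegralD//; apply/eqP.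
under eq_Rintegral do rewrite -DE.
rewrite /Rintegral; apply: (congr1 fine (@integral_derive_eq0 i (psi \* chi) (closed_support psi) _ _ _ _)).
- by move=> x; exact: derivableM.
- move=> x; rewrite (_ : 'D_(e_ i) (psi \* chi) = fun x => psi x * 'D_(e_ i) chi x + 'D_(e_ i) psi x * chi x).
    apply: cvgD; apply: cvgM.
    + exact: test_function_continuous tp _.
    + exact: test_function_derive_continuous tc _.
    + exact: test_function_derive_continuous tp _.
    + exact: test_function_continuous tc _.
  exact/funext.
- by case: tp.
- by move=> x /closed_supportN /= ->; rewrite mul0r.
Qed.

End IntegrationByParts.

(** * Weak derivatives *)

Section SobolevTheory.
Context {R : realType}.
Local Notation mu := (@leb2 R).
Variables (Omega : set (plane R)) (oO : open Omega).
Implicit Types (f g h u v w psi chi : plane R -> R).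

Lemma laplacianE f x : laplacian Omega f x =
  wpartial Omega true (wpartial Omega true f) x +
  wpartial Omega false (wpartial Omega false f) x.
Proof. exact: big_bool. Qed.

Lemma grad_dotE f g x : grad_dot Omega f g x =
  wpartial Omega true f x * wpartial Omega true g x +
  wpartial Omega false f x * wpartial Omega false g x.
Proof. exact: big_bool. Qed.

Let mO : measurable Omega := open_measurable2 oO.

Lemma L2_measurable f : L2 Omega f -> measurable_fun Omega f.
Proof. by case/(L2P _ mO). Qed.

Lemma ae_eq_Rintegral f g : measurable_fun Omega f -> measurable_fun Omega g ->
  f = g %[ae mu in Omega] -> \int[mu]_(x in Omega) f x = \int[mu]_(x in Omega) g x.
Proof.
move=> mf mg fg; rewrite /Rintegral; congr fine; apply: ae_eq_integral => //.
- exact/measurable_EFinP.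
- exact/measurable_EFinP.
- by apply: filterS fg => x + Ox => ->.
Qed.

Lemma ae_eq_normL f g p : L2 Omega f -> L2 Omega g -> f = g %[ae mu in Omega] ->
  normL Omega p f = normL Omega p g.
Proof.
move=> fL gL fg; rewrite /normL unlock.
apply: (congr1 (fun z => z `^ p^-1)%E).
have mE h : L2 Omega h -> measurable_fun setT (fun x => `|(EFin \o (h \_ Omega)) x| `^ p)%E.
  move=> hL; apply: (measurableT_comp (measurable_poweR _)).
  apply: measurableT_comp => //; apply/measurable_EFinP.
  by apply/(measurable_restrictT _ mO); exact: L2_measurable hL.
apply: ae_eq_integral => //; [exact: mE|exact: mE|].
apply: filterS fg => x fg _ /=; rewrite /patch; case: ifPn => //= xO.
by rewrite fg//; rewrite inE in xO.
Qed.

Lemma L2_fin_triangle f g : L2 Omega f -> L2 Omega g ->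
  fine (normL Omega 2 (f \- g)) <= fine (normL Omega 2 f) + fine (normL Omega 2 g).
Proof.
move=> fL gL; have NgL := L2N gL.
have mR h : L2 Omega h -> measurable_fun setT (h \_ Omega).
  by move=> hL; apply/(measurable_restrictT _ mO); exact: L2_measurable hL.
rewrite -lee_fin EFinD !fineK ?L2_normL_fin//; last exact: L2B.
have := eminkowski mu (mR _ fL) (mR _ NgL) (_ : 1 <= 2%:E)%E.
rewrite lee_fin ler1n => /(_ isT); rewrite -/(normL _ _ _).
congr (_ <= _ + _)%E.
  rewrite /normL; congr Lnorm; apply/funext => x /=; congr EFin.
  by rewrite /patch; case: ifP => //; rewrite addr0.
rewrite -oppe_Lnorm; congr Lnorm; apply/funext => x /=; congr EFin.
by rewrite /patch; case: ifP => //; rewrite ?opprK ?oppr0.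
Qed.

Lemma test_functionB psi chi : test_function Omega psi -> test_function Omega chi ->
  test_function Omega (psi \- chi).
Proof.
move=> [sp cp pO] [sc cc cO].
have iB s : iter_partial s (psi \- chi) = iter_partial s psi \- iter_partial s chi.
  elim: s => //= i s ->; apply/funext => x /=.
  by apply: deriveB; [case: (sp s) => _|case: (sc s) => _].
have sub : closed_support (psi \- chi) `<=` closed_support psi `|` closed_support chi.
  apply: closed_support_subset.
    by apply: closedU; exact: closed_closure.
  by move=> x /not_orP[/closed_supportN p0 /closed_supportN c0] /=; rewrite p0 c0 subr0.
split.
- move=> s; rewrite iB; split.
    by move=> x; apply: cvgB; [case: (sp s) => + _; apply|case: (sc s) => + _; apply].
  by move=> i x; apply: derivableB; [case: (sp s) => _|case: (sc s) => _].
- apply: subclosed_compact sub; [exact: closed_closure|exact: compactU].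
- by apply: subset_trans sub _; rewrite subUset.
Qed.

Lemma test_function_subset psi (D : set (plane R)) : Omega `<=` D -> test_function Omega psi ->
  test_function D psi.
Proof. by move=> OD [? ? pO]; split => //; exact: subset_trans pO OD. Qed.

Lemma wpartialP i f : H1 Omega f -> is_weak_partial Omega i f (wpartial Omega i f).
Proof. by move=> [_ /(_ i)]; exact: xgetPex. Qed.

Lemma wpartial_L2 i f : H1 Omega f -> L2 Omega (wpartial Omega i f).
Proof. by move=> /(wpartialP i) []. Qed.

Lemma is_weak_partial_unique i f g h : is_weak_partial Omega i f g ->
  is_weak_partial Omega i f h -> g = h %[ae mu in Omega].
Proof.
move=> [gL Hg] [hL Hh].
have := @fundamental_lemma _ Omega (fun x => g x - h x) oO (L2B gL hL) _.
have H psi : test_function Omega psi -> \int[mu]_(x in Omega) ((g x - h x) * psi x) = 0.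
  move=> tp; have pL := test_function_L2 mO tp.
  under eq_Rintegral do rewrite mulrBl.
  rewrite RintegralB//; [|exact: L2_mul|exact: L2_mul].
  by have := Hg _ tp; rewrite (Hh _ tp) => /oppr_inj ->; rewrite subrr.
by move=> /(_ H); apply: filterS => x + Ox => /(_ Ox)/eqP; rewrite subr_eq0 => /eqP.
Qed.

Lemma is_weak_partial_ae i f f' g : L2 Omega f -> L2 Omega f' ->
  f = f' %[ae mu in Omega] -> is_weak_partial Omega i f g -> is_weak_partial Omega i f' g.
Proof.
move=> fL fL' ff' [gL Hg]; split => // psi tp; rewrite -Hg//.
have dL := test_function_derive_L2 i mO tp.
apply: ae_eq_Rintegral; try by apply: measurable_funM; exact: L2_measurable.
by apply: filterS ff' => x + Ox => ->.
Qed.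

(** An equality of functions and not only almost everywhere: f and f' have the same set of weak
    derivatives, and [xget] chooses from that set. This allows rewriting under a second
    [wpartial]. *)
Lemma wpartial_ae i f f' : L2 Omega f -> L2 Omega f' -> f = f' %[ae mu in Omega] ->
  wpartial Omega i f = wpartial Omega i f'.
Proof.
move=> fL fL' ff'; rewrite /wpartial; congr xget; apply/seteqP; split => g.
  exact: is_weak_partial_ae.
by apply: is_weak_partial_ae => //; apply: filterS ff' => x + Ox => ->.
Qed.

Lemma H1_ae f f' : L2 Omega f' -> f = f' %[ae mu in Omega] -> H1 Omega f -> H1 Omega f'.
Proof.
move=> fL' ff' [fL H]; split => // i; have [g Hg] := H i; exists g.
exact: is_weak_partial_ae Hg.
Qed.

Lemma is_weak_partialB i f f' g g' : L2 Omega f -> L2 Omega f' ->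
  is_weak_partial Omega i f g -> is_weak_partial Omega i f' g' ->
  is_weak_partial Omega i (f \- f') (g \- g').
Proof.
move=> fL fL' [gL Hg] [gL' Hg']; split; first exact: L2B.
move=> psi tp; have pL := test_function_L2 mO tp.
have dL := test_function_derive_L2 i mO tp.
under eq_Rintegral do rewrite mulrBl.
rewrite RintegralB//; [|exact: L2_mul|exact: L2_mul].
under [in RHS]eq_Rintegral do rewrite mulrBl.
rewrite RintegralB//; [|exact: L2_mul|exact: L2_mul].
by rewrite Hg// Hg'// opprB opprK addrC.
Qed.

Lemma H1B f g : H1 Omega f -> H1 Omega g -> H1 Omega (f \- g).
Proof.
move=> fH gH; split; first by apply: L2B; [case: fH|case: gH].
move=> i; exists (wpartial Omega i f \- wpartial Omega i g).
by apply: is_weak_partialB; [case: fH|case: gH|exact: wpartialP|exact: wpartialP].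
Qed.

Lemma wpartialB i f g : H1 Omega f -> H1 Omega g ->
  wpartial Omega i (f \- g) = wpartial Omega i f \- wpartial Omega i g %[ae mu in Omega].
Proof.
move=> fH gH; apply: (@is_weak_partial_unique i (f \- g)).
  by apply: wpartialP; exact: H1B.
by apply: is_weak_partialB; [case: fH|case: gH|exact: wpartialP|exact: wpartialP].
Qed.

Lemma H2B f g : H2 Omega f -> H2 Omega g -> H2 Omega (f \- g).
Proof.
move=> [fH f2] [gH g2]; split; first exact: H1B.
move=> i; apply: (H1_ae _ _ (H1B (f2 i) (g2 i))).
  by apply: wpartial_L2; exact: H1B.
by apply: filterS (wpartialB i fH gH) => x + Ox => ->.
Qed.

Lemma laplacianB f g : H2 Omega f -> H2 Omega g ->
  laplacian Omega (f \- g) = (fun x => laplacian Omega f x - laplacian Omega g x)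
  %[ae mu in Omega].
Proof.
move=> [fH f2] [gH g2].
have E i : wpartial Omega i (wpartial Omega i (f \- g)) =
    wpartial Omega i (wpartial Omega i f) \- wpartial Omega i (wpartial Omega i g)
    %[ae mu in Omega].
  (* The inner derivative of a difference splits only almost everywhere; the outer derivative does
     not see the null set. *)
  rewrite (@wpartial_ae i _ (wpartial Omega i f \- wpartial Omega i g)).
  - exact: wpartialB.
  - by apply: wpartial_L2; exact: H1B.
  - by apply: L2B; exact: wpartial_L2.
  - exact: wpartialB.
apply: filterS2 (E false) (E true) => x E0 E1 Ox.
by rewrite !laplacianE (E0 Ox) (E1 Ox) opprD addrACA.
Qed.

Lemma laplacian_L2 f : H2 Omega f -> L2 Omega (laplacian Omega f).
Proof.
move=> [_ f2].
apply: (@L2_ext _ _ (fun x => wpartial Omega true (wpartial Omega true f) x +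
  wpartial Omega false (wpartial Omega false f) x)); first by move=> x _; rewrite laplacianE.
by apply: L2D; exact: wpartial_L2.
Qed.

Lemma H10_H1 f : H10 Omega f -> H1 Omega f. Proof. by case. Qed.

(** [f n] is tied to [a n \- b n] through its norm only, because the weak derivative of a difference
    splits only almost everywhere. *)
Lemma cvg_normLB (a b f : nat -> plane R -> R) :
  (forall n, L2 Omega (a n)) -> (forall n, L2 Omega (b n)) ->
  (forall n, normL Omega 2 (f n) = normL Omega 2 (a n \- b n)) ->
  (fun n => normL Omega 2 (a n)) @ \oo --> 0%E ->
  (fun n => normL Omega 2 (b n)) @ \oo --> 0%E ->
  (fun n => normL Omega 2 (f n)) @ \oo --> 0%E.
Proof.
move=> aL bL fE a0 b0.
under eq_fun do rewrite fE.
apply: (@squeeze_cvge _ _ _ _ (cst 0%E) _ (fun n => normL Omega 2 (a n) + normL Omega 2 (b n))%E).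
- apply: nearW => n; rewrite Lnorm_ge0/=.
  rewrite -(@fineK _ (normL _ _ (a n \- b n))) ?L2_normL_fin//; last exact: L2B.
  rewrite -(@fineK _ (normL _ _ (a n))) ?L2_normL_fin//.
  rewrite -(@fineK _ (normL _ _ (b n))) ?L2_normL_fin// -EFinD lee_fin.
  exact: L2_fin_triangle.
- exact: cvg_cst.
- by rewrite -[X in _ --> X]adde0; apply: cvgeD.
Qed.

Lemma H10B f g : H10 Omega f -> H10 Omega g -> H10 Omega (f \- g).
Proof.
move=> [fH [ps [tps psf dps]]] [gH [ch [tch chg dch]]].
have fL : L2 Omega f by case: fH. have gL : L2 Omega g by case: gH.
split; first exact: H1B.
exists (fun n => ps n \- ch n); split.
- by move=> n; exact: test_functionB.
- apply: (cvg_normLB _ _ _ psf chg).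
  + by move=> n; apply: L2B => //; exact: test_function_L2 (tps n).
  + by move=> n; apply: L2B => //; exact: test_function_L2 (tch n).
  + by move=> n; apply: normL_ext => x _ /=; rewrite !opprB addrACA [RHS]addrACA [- ch n x + _]addrC.
- move=> i; apply: (cvg_normLB _ _ _ (dps i) (dch i)).
  + by move=> n; apply: L2B; [exact: test_function_derive_L2 (tps n)|exact: wpartial_L2].
  + by move=> n; apply: L2B; [exact: test_function_derive_L2 (tch n)|exact: wpartial_L2].
  + move=> n; apply: ae_eq_normL.
    * apply: L2B; last by apply: wpartial_L2; exact: H1B.
      exact: (test_function_derive_L2 i mO (test_functionB (tps n) (tch n))).
    * apply: L2B; apply: L2B.
      - exact: test_function_derive_L2 (tps n).
      - exact: wpartial_L2.
      - exact: test_function_derive_L2 (tch n).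
      - exact: wpartial_L2.
    apply: filterS (wpartialB i fH gH) => x E Ox; rewrite E//=.
    rewrite deriveB; [|exact: test_function_derivable (tps n)|exact: test_function_derivable (tch n)].
    by rewrite !opprB addrACA [RHS]addrACA [- 'D_(e_ i) (ch n) x + _]addrC.
Qed.

(** When v is a test function, each summand is the definition of the weak derivative of
    [wpartial Omega i y]; the approximation of v in H1 by test functions carries it over without a
    boundary term. *)
Lemma Green y v : H2 Omega y -> H10 Omega v ->
  \int[mu]_(x in Omega) (laplacian Omega y x * v x) =
  - \int[mu]_(x in Omega) grad_dot Omega y v x.
Proof.
move=> [yH y2] [vH [ps [tps psv dps]]].
have vL : L2 Omega v by case: vH.
have part i : \int[mu]_(x in Omega) (v x * wpartial Omega i (wpartial Omega i y) x) =
    - \int[mu]_(x in Omega) (wpartial Omega i v x * wpartial Omega i y x).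
  have c1 := L2_cvg_int mO (fun n => test_function_L2 mO (tps n)) vL (wpartial_L2 i (y2 i)) psv.
  have c2 := L2_cvg_int mO (fun n => test_function_derive_L2 i mO (tps n)) (wpartial_L2 i vH) (wpartial_L2 i yH) (dps i).
  rewrite -(cvg_lim (@norm_hausdorff _ R) c1) -(cvg_lim (@norm_hausdorff _ R) (cvgN c2)).
  congr (lim (_ @ \oo)); apply/funext => n /=.
  have [_ /(_ _ (tps n)) H] := wpartialP i (y2 i).
  under eq_Rintegral do rewrite mulrC.
  rewrite -[LHS]opprK -H; congr (- _).
  by apply: eq_Rintegral => x _; rewrite mulrC.
have I1 i := L2_mul mO vL (wpartial_L2 i (y2 i)).
have I2 i := L2_mul mO (wpartial_L2 i vH) (wpartial_L2 i yH).
transitivity (\int[mu]_(x in Omega) (v x * wpartial Omega true (wpartial Omega true y) x +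
    v x * wpartial Omega false (wpartial Omega false y) x)).
  by apply: eq_Rintegral => x _; rewrite laplacianE mulrC mulrDr.
apply: (etrans (RintegralD mO (I1 true) (I1 false))).
apply: (etrans (congr2 +%R (part true) (part false))).
rewrite -opprD; congr (- _).
apply: (etrans (esym (RintegralD mO (I2 true) (I2 false)))).
by apply: eq_Rintegral => x _; rewrite grad_dotE; congr (_ + _); exact: mulrC.
Qed.

End SobolevTheory.

(** * Extension by zero and the Gagliardo-Nirenberg inequality *)

Section Extension.
Context {R : realType}.
Local Notation mu := (@leb2 R).
Variables (Omega : set (plane R)) (oO : open Omega).
Implicit Types (f g h u v w psi chi : plane R -> R).

Let mO : measurable Omega := open_measurable2 oO.

Lemma L2_zero_extension f : L2 Omega f -> L2 setT (f \_ Omega).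
Proof. by rewrite /L2 patch_setT. Qed.

Lemma Rintegral_zero_extension f g :
  \int[mu]_x ((f \_ Omega) x * g x) = \int[mu]_(x in Omega) (f x * g x).
Proof.
rewrite [RHS]Rintegral_mkcond; apply: eq_Rintegral => x _.
by rewrite /patch; case: ifP => //; rewrite mul0r.
Qed.

Lemma test_function_restrict psi chi : test_function Omega psi ->
  \int[mu]_x (psi x * chi x) = \int[mu]_(x in Omega) (psi x * chi x).
Proof.
move=> [_ _ pO]; rewrite -Rintegral_zero_extension; apply: eq_Rintegral => x _.
congr (_ * _); rewrite /patch; case: ifPn => // /negP xO.
by rewrite closed_supportN// => /pO xO'; apply: xO; exact: mem_set.
Qed.

Lemma test_function_derive_restrict i psi chi : test_function Omega psi ->
  \int[mu]_x ('D_(e_ i) psi x * chi x) = \int[mu]_(x in Omega) ('D_(e_ i) psi x * chi x).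
Proof.
move=> [_ _ pO]; rewrite -Rintegral_zero_extension; apply: eq_Rintegral => x _.
congr (_ * _); rewrite /patch; case: ifPn => // /negP xO.
by rewrite derive_closed_supportN// => /pO xO'; apply: xO; exact: mem_set.
Qed.

(** A test function [psi] of the plane need not vanish near the boundary of [Omega], so it cannot be
    used in the weak derivative on [Omega]. The compact support is provided instead by the
    approximants [ps n] of f, for which integration by parts against [psi] is classical. *)
Lemma is_weak_partial_zero_extension i f : H10 Omega f ->
  is_weak_partial setT i (f \_ Omega) (wpartial Omega i f \_ Omega).
Proof.
move=> [fH [ps [tps psf dps]]]; have fL : L2 Omega f by case: fH.
split; first by apply: L2_zero_extension; exact: wpartial_L2.
move=> psi tp; rewrite !Rintegral_zero_extension.
have c1 := L2_cvg_int mO (fun n => test_function_L2 mO (tps n)) fL (test_function_derive_L2 i mO tp) psf.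
have c2 := L2_cvg_int mO (fun n => test_function_derive_L2 i mO (tps n)) (wpartial_L2 i fH) (test_function_L2 mO tp) (dps i).
rewrite -(cvg_lim (@norm_hausdorff _ R) c1) -(cvg_lim (@norm_hausdorff _ R) (cvgN c2)).
congr (lim (_ @ \oo)); apply/funext => n /=.
apply: (etrans (esym (test_function_restrict _ (tps n)))).
have tpn : test_function setT (ps n) by exact: test_function_subset (tps n).
apply: (etrans (integration_by_parts2 i tpn tp)).
by congr (- _); exact: test_function_derive_restrict.
Qed.

Lemma H1_zero_extension f : H10 Omega f -> H1 setT (f \_ Omega).
Proof.
move=> fH; split; first by apply: L2_zero_extension; case: fH => -[].
by move=> i; exists (wpartial Omega i f \_ Omega); exact: is_weak_partial_zero_extension.
Qed.

Lemma wpartial_zero_extension i f : H10 Omega f ->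
  wpartial setT i (f \_ Omega) = wpartial Omega i f \_ Omega %[ae mu].
Proof.
move=> fH; apply: (is_weak_partial_unique openT).
  by apply: wpartialP; exact: H1_zero_extension.
exact: is_weak_partial_zero_extension.
Qed.

Definition norm_grad (D : set (plane R)) f : plane R -> R :=
  fun x => Num.sqrt (grad_dot D f f x).

Lemma grad_dot_ge0 (D : set (plane R)) f x : 0 <= grad_dot D f f x.
Proof. by apply: sumr_ge0 => i _; rewrite -expr2 sqr_ge0. Qed.

Lemma norm_gradE (D : set (plane R)) f x : norm_grad D f x =
  Num.sqrt (wpartial D true f x * wpartial D true f x +
            wpartial D false f x * wpartial D false f x).
Proof. by rewrite /norm_grad grad_dotE. Qed.

Lemma sqr_norm_grad (D : set (plane R)) f x : norm_grad D f x ^+ 2 = grad_dot D f f x.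
Proof. by apply: sqr_sqrtr; exact: grad_dot_ge0. Qed.

Lemma grad_dot_integrable (D : set (plane R)) f g : measurable D -> H1 D f -> H1 D g ->
  mu.-integrable D (EFin \o grad_dot D f g).
Proof.
move=> mD fH gH.
have I i := L2_mul mD (wpartial_L2 i fH) (wpartial_L2 i gH).
have := integrableD mD (I true) (I false).
by apply: eq_integrable => // x _; rewrite [RHS]/= grad_dotE EFinD.
Qed.

Lemma norm_grad_L2 (D : set (plane R)) f : measurable D -> H1 D f -> L2 D (norm_grad D f).
Proof.
move=> mD fH; have I := grad_dot_integrable mD fH fH.
apply/(L2P _ mD); split.
  apply: (measurableT_comp (@continuous_measurable_fun R Num.sqrt (@sqrt_continuous R))).
  by apply/measurable_EFinP; case/integrableP : I.
by apply: eq_integrable I => // x _; rewrite [RHS]/= sqr_norm_grad.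
Qed.

(* The constant in the hypothesis is only an upper bound of an infimum, so the
   inequality is obtained for all K > C first. *)
Lemma GN_H10 (q C : R) v : 2 < q -> 0 <= C -> (GN_optimal_constant q <= C%:E)%E ->
  H10 Omega v ->
  (normL Omega q v <= (C * fine (normL Omega 2 v) `^ (2 / q) *
    Num.sqrt (\int[mu]_(x in Omega) grad_dot Omega v v x) `^ ((q - 2) / q))%:E)%E.
Proof.
move=> q2 C0 GNC vH.
have vH1 := H10_H1 vH; have vL : L2 Omega v by case: vH1.
set A := \int[mu]_(x in Omega) _.
have gL := norm_grad_L2 mO vH1.
have gA : fine (normL Omega 2 (norm_grad Omega v)) = Num.sqrt A.
  rewrite -[LHS]ger0_norm ?fine_ge0 ?Lnorm_ge0// -sqrtr_sqr (sqr_normL mO gL).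
  by congr Num.sqrt; apply: eq_Rintegral => x _; exact: sqr_norm_grad.
have vE := H1_zero_extension vH.
have nE : normL setT 2 (norm_grad setT (v \_ Omega)) = (Num.sqrt A)%:E.
  rewrite -gA fineK ?L2_normL_fin//.
  transitivity (normL setT 2 (norm_grad Omega v \_ Omega)); last first.
    by rewrite /normL patch_setT.
  apply: (ae_eq_normL openT).
  - exact: norm_grad_L2.
  - exact: L2_zero_extension.
  - have := wpartial_zero_extension true vH; have := wpartial_zero_extension false vH.
    apply: filterS2 => x h0 h1 _; 
    apply: (etrans (norm_gradE _ _ _)).
    have H (a b c d : R) : a = c -> b = d -> Num.sqrt (a * a + b * b) = Num.sqrt (c * c + d * d).
      by move=> -> ->.
    have [xO|xO] := boolP (x \in Omega).
      rewrite (patchT _ _ xO); apply: etrans (esym (norm_gradE _ _ _)).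
      by apply: H; [apply: (etrans (h1 I))|apply: (etrans (h0 I))]; exact: patchT.
    rewrite (patchN _ _ xO).
    apply: (etrans (H _ _ 0 0 (etrans (h1 I) (patchN _ _ xO)) (etrans (h0 I) (patchN _ _ xO)))).
    by rewrite mul0r addr0 sqrtr0.
have vq : normL setT q (v \_ Omega) = normL Omega q v by rewrite /normL patch_setT.
have v2 : normL setT 2 (v \_ Omega) = (fine (normL Omega 2 v))%:E.
  by rewrite fineK ?L2_normL_fin// /normL patch_setT.
set T := fine (normL Omega 2 v) `^ (2 / q) * Num.sqrt A `^ ((q - 2) / q).
have T0 : 0 <= T by rewrite mulr_ge0 ?powR_ge0.
have GNK K : 0 <= K -> GN_inequality q K -> (normL Omega q v <= (K * T)%:E)%E.
  move=> K0 /(_ _ vE); rewrite -/(norm_grad _ _) vq v2 nE.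
  by rewrite !poweR_EFin -!EFinM mulrA.
rewrite -mulrA -/T.
apply/lee_addgt0Pr => e e0.
(* T may be 0, hence the denominator T + 1; the resulting error e T / (T + 1) is at most e. *)
have e1 : 0 < e / (T + 1) by rewrite divr_gt0// ltr_wpDl.
have : (GN_optimal_constant q < (C + e / (T + 1))%:E)%E.
  by apply: le_lt_trans GNC _; rewrite lte_fin ltrDl.
move=> /ereal_inf_lt [_ [K [K0 GK] <-]]; rewrite lte_fin => KC.
apply: le_trans (GNK _ K0 GK) _; rewrite -EFinD lee_fin.
apply: le_trans (ler_wpM2r T0 (ltW KC)) _; rewrite mulrDl lerD2l.
have T1 : 0 < T + 1 by rewrite ltr_wpDl.
by rewrite mulrAC ler_pdivrMr ?ler_pM2l ?lerDl.
Qed.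

End Extension.

(** * Continuous functions on the closure of an open set *)

Section Closure.
Context {R : realType}.
Local Notation mu := (@leb2 R).
Implicit Types (Omega : set (plane R)) (f g h u v w psi chi : plane R -> R).

(** The set where f is nonzero is relatively open in the closure. If it is nonempty, it meets
    [Omega] in a nonempty open set, which has positive measure. *)
Lemma continuous_ae_eq0 Omega f : open Omega -> {within closure Omega, continuous f} ->
  f = cst 0 %[ae mu in Omega] -> forall x, closure Omega x -> f x = 0.
Proof.
move=> oO /continuousP cf [N [mN N0 fN]] x Ox; apply: contrapT => fx.
have oab : open [set y : R | y != 0].
  by have := @open_neq R 0.
have /open_subspaceP[V oV VE] := cf _ oab.
have Vx : V x.
  have : (from_subspace (closure Omega) f @^-1` [set y | y != 0] `&` closure Omega) x.
    by split => //=; apply/eqP.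
  by rewrite -VE => -[].
have [y [Oy Vy]] := Ox V (open_nbhs_nbhs (conj oV Vx)).
have oVO : open (V `&` Omega) by exact: openI.
have := open_leb2_gt0 oVO (ex_intro _ y (conj Vy Oy)).
apply/negP; rewrite -leNgt -N0; apply: le_measure; rewrite ?inE//.
  exact: open_measurable2.
move=> z [Vz Oz]; apply: fN => /= fz.
have : (V `&` closure Omega) z by split => //; exact: subset_closure.
rewrite VE => -[fz0 _]; move: (fz0 : f z != 0); by rewrite (fz Oz) eqxx.
Qed.

Lemma bounded_set_cbox Omega : bounded_set Omega -> exists2 N : R, 0 < N & Omega `<=` cbox (- N) N (- N) N.
Proof.
move=> [M [_ HM]]; exists (`|M| + 1); first by rewrite ltr_pwDr.
move=> x Sx; have : `|x| <= `|M| + 1 by apply: HM => //; rewrite ltr_pwDr// ler_norm.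
by rewrite prod_normE ge_max => /andP[h1 h2]; apply/cboxP; rewrite -!ler_norml.
Qed.

Lemma bounded_closure_compact Omega : bounded_set Omega -> compact (closure Omega).
Proof.
move=> /bounded_set_cbox[N N0 ON]; apply: (@subclosed_compact _ _ (cbox (- N) N (- N) N)).
- exact: closed_closure.
- exact: cbox_compact.
rewrite [X in _ `<=` X](closure_id _).1; last exact: cbox_closed.
exact: closure_subset.
Qed.

Lemma bounded_leb2_lty Omega : measurable Omega -> bounded_set Omega -> (mu Omega < +oo)%E.
Proof.
move=> mO /bounded_set_cbox[N N0 ON].
apply: le_lt_trans (leb2_cbox_lty (- N) N (- N) N).
by apply: le_measure; rewrite ?inE//; exact: measurable_cbox.
Qed.

Lemma continuous_closure_bounded Omega f : bounded_set Omega ->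
  {within closure Omega, continuous f} -> exists C, forall x, Omega x -> `|f x| <= C.
Proof.
move=> /bounded_closure_compact cO cf.
have [M [_ HM]] : bounded_set (f @` closure Omega).
  by apply: compact_bounded; exact: continuous_compact.
exists (`|M| + 1) => x Ox; apply: HM; first by rewrite ltr_pwDr// ler_norm.
by exists x => //; exact: subset_closure.
Qed.

End Closure.

(** * Taylor remainder *)

Section RealInequalities.
Context {R : realType}.
Implicit Types (a b c t x y z : R).

Lemma amgm2 t x y : 0 < t < 1 -> 0 <= x -> 0 <= y ->
  x `^ t * y `^ (1 - t) <= t * x + (1 - t) * y.
Proof.
move=> /andP[t0 t1] x0 y0; have u0 : 0 < 1 - t by rewrite subr_gt0.
have := @conjugate_powR R (x `^ t) (y `^ (1 - t)) t^-1 (1 - t)^-1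
  (powR_ge0 _ _) (powR_ge0 _ _).
rewrite !invr_gt0 t0 u0 !invrK => /(_ isT isT); rewrite addrCA subrr addr0 => /(_ erefl).
by rewrite -!powRrM !mulfV ?gt_eqF// !powRr1// [x * _]mulrC [y * _]mulrC.
Qed.

(** [amgm2] nested: the weight a against the rest, and inside the rest the weights b / (1 - a) and c
    / (1 - a). *)
Lemma amgm3 a b c x y z : 0 < a -> 0 < b -> 0 < c -> a + b + c = 1 ->
  0 <= x -> 0 <= y -> 0 <= z ->
  x `^ a * y `^ b * z `^ c <= a * x + b * y + c * z.
Proof.
move=> a0 b0 c0 abc x0 y0 z0.
have a1 : 0 < a < 1 by apply/andP; split=> //; lra.
have d0 : 0 < 1 - a by case/andP: a1 => _; rewrite subr_gt0.
have t01 : 0 < b / (1 - a) < 1.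
  by rewrite divr_gt0//= ltr_pdivrMr// mul1r; lra.
have e : 1 - b / (1 - a) = c / (1 - a).
  have -> : c = (1 - a) - b by lra.
  by rewrite mulrBl divff// lt0r_neq0.
have := amgm2 t01 y0 z0; rewrite e => H.
have := amgm2 a1 x0 (mulr_ge0 (powR_ge0 y (b / (1 - a))) (powR_ge0 z (c / (1 - a)))).
rewrite powRM ?powR_ge0// -!powRrM !divfK ?gt_eqF// mulrA => /le_trans; apply.
rewrite -addrA lerD2l (le_trans (ler_wpM2l (ltW d0) H))//.
have n0 : 1 - a != 0 by rewrite gt_eqF.
by rewrite le_eqVlt; apply/orP; left; apply/eqP; field.
Qed.

Lemma continuous_le_left (f : R -> R) x c : continuous f ->
  (forall s, 0 <= s -> s < x -> f s <= c) -> 0 < x -> f x <= c.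
Proof.
move=> cf H x0; have cfx : f @ x^'- --> f x by apply: cvg_at_left_filter; exact: cf.
rewrite -(cvg_lim (@norm_hausdorff _ R) cfx); apply: limr_le; first by apply/cvg_ex; exists (f x).
near=> s; apply: H.
  by apply: ltW; near: s; exact: nbhs_left_gt.
by near: s; exact: nbhs_left_lt.
Unshelve. all: by end_near. Qed.

Section TaylorRemainder.
Variables (phi : R -> R) (M theta : R).
Hypotheses (dphi : forall s, derivable phi s 1)
  (ddphi : forall s, derivable (derive1 phi) s 1)
  (phi'_ge0 : forall s, 0 <= derive1 phi s)
  (M0 : 0 < M) (theta01 : 0 < theta < 1)
  (hphi'' : forall s, `|derive1n 2 phi s| <= M * (derive1 phi s) `^ theta).
Variables (a v B : R) (B0 : 0 < B) (v0 : v != 0)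
  (hB : (phi (a + v) - phi a) / v <= B).

(** These come from Hölder for the integral over [0, 1] of (1 - t) phi'(a + t v)^theta, with
    exponents [k] and 1/theta: [A] is the integral of (1 - t)^k, [B] bounds the mean of phi' on the
    segment, and [z] is the resulting bound. *)
Let k := (1 - theta)^-1.
Let A := (1 - theta) / (2 - theta).
Let z := A `^ (1 - theta) * B `^ theta.

Let th0 : 0 < theta. Proof. by case/andP: theta01. Qed.
Let u0 : 0 < 1 - theta. Proof. by case/andP: theta01; rewrite subr_gt0. Qed.
Let u2 : 0 < 2 - theta. Proof. by have := u0; lra. Qed.
Let A0 : 0 < A. Proof. by rewrite divr_gt0. Qed.
Let z0 : 0 < z. Proof. by rewrite mulr_gt0 ?powR_gt0. Qed.
Let k1A : (k + 1) * A = 1.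
Proof. by rewrite /k /A; field; rewrite !lt0r_neq0. Qed.

(* H interpolates between the two sides of the Taylor expansion and
   H' = (1 - t) v^2 phi''.  By Young, |H'| is at most the derivative of L + P, an
   explicit primitive, so the integral remainder and its Hölder estimate are
   replaced by monotonicity of L + P - H and L + P + H on [0, 1[; P is not
   differentiable at 1. *)
Let H (t : R) : R := phi (a + t * v) + (1 - t) * v * derive1 phi (a + t * v).
Let L (t : R) : R := M * v ^+ 2 * z * (theta * phi (a + t * v) / (v * B)).
Let P (t : R) : R := M * v ^+ 2 * z * (- ((1 - theta) * (1 - t) `^ (k + 1))).

Let is_derive_line (t : R) : is_derive t (1 : R) (fun t : R => a + t * v) v.
Proof. by apply: is_derive_eq; rewrite /GRing.scale/=; ring. Qed.

Let is_derive_phi (t : R) : is_derive t (1 : R) (fun t : R => phi (a + t * v)) (derive1 phi (a + t * v) * v).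
Proof.
apply: (@is_derive1_comp _ phi); last exact: is_derive_line.
by rewrite derive1E; exact: derivableP.
Qed.

Let is_derive_phi' (t : R) : is_derive t (1 : R) (fun t : R => derive1 phi (a + t * v)) (derive1n 2 phi (a + t * v) * v).
Proof.
apply: (@is_derive1_comp _ (derive1 phi)); last exact: is_derive_line.
by rewrite derive1nS derive1n1 derive1E; exact: derivableP.
Qed.

Let is_derive_H (t : R) : is_derive t (1 : R) H ((1 - t) * v ^+ 2 * derive1n 2 phi (a + t * v)).
Proof.
have h1 := is_derive_phi t; have h2 := is_derive_phi' t.
have h3 : is_derive t (1 : R) (fun t : R => (1 - t) * v) (- v).
  by apply: is_derive_eq; rewrite /GRing.scale/=; ring.
have h4 := is_deriveM h3 h2; have h5 := is_deriveD h1 h4.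
by apply: is_derive_eq h5 _; rewrite /GRing.scale/=; ring.
Qed.

Let is_derive_L (t : R) : is_derive t (1 : R) L (M * v ^+ 2 * z * (theta * derive1 phi (a + t * v) / B)).
Proof.
have h1 := is_derive_phi t.
have h2 := is_deriveZ (M * v ^+ 2 * z * (theta / (v * B))) h1.
rewrite (_ : L = (M * v ^+ 2 * z * (theta / (v * B))) *: (fun t : R => phi (a + t * v))); last first.
  by apply/funext => s; rewrite /L fctE /GRing.scale/=; ring.
by apply: is_derive_eq h2 _; rewrite /GRing.scale/=; field; rewrite v0 gt_eqF.
Qed.

Let is_derive_P (t : R) : t < 1 ->
  is_derive t (1 : R) P (M * v ^+ 2 * z * ((1 - theta) * (1 - t) `^ k / A)).
Proof.
move=> t1; have t1' : 1 - t \in `]0, +oo[ by rewrite in_itv/= andbT subr_gt0.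
have h0 : is_derive (1 - t) (1 : R) (fun x : R => x `^ (k + 1)) ((k + 1) * (1 - t) `^ k).
  apply: DeriveDef; first exact: derivable_powR.
  by rewrite -derive1E powR_derive1// addrK.
have h1 : is_derive t (1 : R) (fun t : R => 1 - t) (-1).
  by apply: is_derive_eq; rewrite add0r mul1r.
have h2 := @is_derive1_comp R (fun x : R => x `^ (k + 1)) (fun t : R => 1 - t) t _ _ h0 h1.
have h3 := is_deriveZ (- (M * v ^+ 2 * z * (1 - theta))) h2.
rewrite (_ : P = (- (M * v ^+ 2 * z * (1 - theta))) *: ((fun x : R => x `^ (k + 1)) \o (fun t : R => 1 - t))); last first.
  by apply/funext => s; rewrite -[RHS]/(- (M * v ^+ 2 * z * (1 - theta)) * (1 - s) `^ (k + 1)) /P; ring.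
apply: is_derive_eq h3 _; rewrite /GRing.scale/=.
have -> : k + 1 = A^-1 by apply: (mulIf (lt0r_neq0 A0)); rewrite k1A mulVf// lt0r_neq0.
by ring.
Qed.

Let H'_le (t : R) : 0 <= t -> t < 1 ->
  `|(1 - t) * v ^+ 2 * derive1n 2 phi (a + t * v)| <=
  M * v ^+ 2 * z * ((1 - theta) * (1 - t) `^ k / A) + M * v ^+ 2 * z * (theta * derive1 phi (a + t * v) / B).
Proof.
move=> t0 t1; have s0 : 0 <= 1 - t by rewrite subr_ge0 ltW.
set p' := derive1 phi _; have p'0 : 0 <= p' by exact: phi'_ge0.
rewrite normrM (ger0_norm (mulr_ge0 s0 (sqr_ge0 v))).
apply: (@le_trans _ _ (M * v ^+ 2 * ((1 - t) * p' `^ theta))).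
  rewrite [leRHS](_ : _ = (1 - t) * v ^+ 2 * (M * p' `^ theta)); last by ring.
  by apply: ler_wpM2l; [rewrite mulr_ge0 ?sqr_ge0|exact: hphi''].
rewrite -[leRHS]mulrDr -[leRHS]mulrA; apply: ler_wpM2l; first by rewrite mulr_ge0 ?sqr_ge0 ?ltW.
(* Dividing by B and A normalizes the integrals over [0, 1] of the two factors to at most 1, so that
   Young, once integrated, gives the Hölder bound [z]. *)
have := @amgm2 theta (p' / B) ((1 - t) `^ k / A) theta01.
move=> /(_ (divr_ge0 p'0 (ltW B0)) (divr_ge0 (powR_ge0 _ _) (ltW A0))) am.
rewrite [X in z * X](_ : _ = theta * (p' / B) + (1 - theta) * ((1 - t) `^ k / A)); last by ring.
apply: le_trans (ler_wpM2l (ltW z0) am).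
rewrite (@powRM _ p') ?invr_ge0 ?(ltW B0)// (@powRM _ ((1 - t) `^ k)) ?powR_ge0 ?invr_ge0 ?(ltW A0)//.
rewrite -(powRrM _ k) /k mulVf ?(lt0r_neq0 u0)// powRr1// /z.
rewrite -(powR_inv1 (ltW B0)) -(powR_inv1 (ltW A0)) -!powRrM !mulN1r !powRN.
have Ap : A `^ (1 - theta) != 0 by rewrite gt_eqF// powR_gt0.
have Bp : B `^ theta != 0 by rewrite gt_eqF// powR_gt0.
rewrite le_eqVlt; apply/orP; left; apply/eqP; field.
by rewrite Ap Bp.
Qed.

Lemma taylor_remainder_param :
  `|phi (a + v) - phi a - derive1 phi a * v| <= M * v ^+ 2 * (A `^ (1 - theta) * B `^ theta).
Proof.
have cont (f df : R -> R) : (forall t : R, is_derive t (1 : R) f (df t)) -> continuous f.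
  move=> h t; apply: differentiable_continuous; apply/derivable1_diffP.
  by case: (h t).
have cH := cont _ _ is_derive_H; have cL := cont _ _ is_derive_L.
(* The sign e treats the upper and the lower bound together. *)
have step (e : R) : `|e| = 1 -> forall s, 0 <= s -> s < 1 -> e * H s - L s <= e * H 0 - L 0 - P 0.
  move=> e1 s s0 s1.
  pose f (t : R) := L t + P t - e * H t.
  have df t : t < 1 -> is_derive t (1 : R) f
     (M * v ^+ 2 * z * (theta * derive1 phi (a + t * v) / B) + M * v ^+ 2 * z * ((1 - theta) * (1 - t) `^ k / A) -
      e * ((1 - t) * v ^+ 2 * derive1n 2 phi (a + t * v))).
    move=> t1; exact: (is_deriveB (is_deriveD (is_derive_L t) (is_derive_P t1)) (is_deriveZ e (is_derive_H t))).
  have fle : f 0 <= f s.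
    apply: (@ger0_derive1_ndecr R f 0 s _ _ _ 0 s (lexx _) s0 (lexx _)).
    - by move=> x; rewrite in_itv/= => /andP[_ xs]; case: (df x (lt_trans xs s1)).
    - move=> x; rewrite in_itv/= => /andP[x0 xs]; rewrite derive1E.
      have [_ ->] := df x (lt_trans xs s1).
      rewrite subr_ge0 [leRHS]addrC; apply: le_trans (H'_le (ltW x0) (lt_trans xs s1)).
      by rewrite (le_trans (ler_norm _))// normrM e1 mul1r.
    - apply: derivable_within_continuous => x; rewrite in_itv/= => /andP[_ xs].
      by case: (df x (le_lt_trans xs s1)).
  have P0 : P s <= 0.
    rewrite /P mulrN oppr_le0.
    exact: (mulr_ge0 (mulr_ge0 (mulr_ge0 (ltW M0) (sqr_ge0 v)) (ltW z0)) (mulr_ge0 (ltW u0) (powR_ge0 _ _))).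
  by move: fle P0; rewrite /f; move: (L s) (L 0) (P s) (P 0) (e * H s) (e * H 0) => l l0 p p0 h h0; lra.
have H0 : H 0 = phi a + derive1 phi a * v by rewrite /H mul0r addr0 subr0 mul1r [v * _]mulrC.
have H1 : H 1 = phi (a + v) by rewrite /H mul1r subrr !mul0r addr0.
have P0 : - P 0 = M * v ^+ 2 * z - M * v ^+ 2 * z * theta.
  by rewrite /P subr0 powR1 mulr1 mulrN opprK mulrBr mulr1.
have L1 : L 1 - L 0 <= M * v ^+ 2 * z * theta.
  rewrite /L mul1r mul0r addr0 -mulrBr; apply: ler_wpM2l.
    exact: (mulr_ge0 (mulr_ge0 (ltW M0) (sqr_ge0 v)) (ltW z0)).
  rewrite (_ : _ - _ = theta * (((phi (a + v) - phi a) / v) / B)); last first.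
    by field; rewrite v0 gt_eqF.
  by rewrite ler_piMr ?(ltW th0)// ler_pdivrMr// mul1r.
(* The two primitives contribute the fractions 1 - theta (from [P]) and at most theta (from [L]) of
   M v^2 z. The end point 1 is reached by continuity of [H] and [L] alone. *)
have fin (e : R) : `|e| = 1 -> e * (H 1 - H 0) <= M * v ^+ 2 * z.
  move=> e1; have : e * H 1 - L 1 <= e * H 0 - L 0 - P 0.
    apply: (@continuous_le_left (fun s => e * H s - L s)) => //; last exact: step.
    by move=> x; apply: cvgB; [apply: cvgM; [exact: cvg_cst|exact: cH]|exact: cL].
  rewrite mulrBr; move: P0 L1.
  by move: (L 1) (L 0) (P 0) (e * H 1) (e * H 0) (M * v ^+ 2 * z * theta) (M * v ^+ 2 * z) => *; lra.
rewrite -/z (_ : _ - _ - _ = H 1 - H 0); last by rewrite H0 H1; ring.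
rewrite ler_norml; apply/andP; split.
  by have := fin (-1); rewrite normrN1 => /(_ erefl); lra.
by have := fin 1; rewrite normr1 => /(_ erefl); lra.
Qed.

End TaylorRemainder.
End RealInequalities.

Section Remainder.
Context {R : realType}.
Implicit Types (a b c t x y z : R).

Lemma nondecreasing_derive1_ge0 (phi : R -> R) : {homo phi : s t / s <= t} ->
  (forall s, derivable phi s 1) -> forall s, 0 <= derive1 phi s.
Proof.
move=> hphi dphi s; rewrite derive1E; have := dphi s; rewrite /derivable /derive => ex.
apply: limr_ge => //; near=> h; rewrite /GRing.scale/= mulr1.
have [h0|h0] := leP 0 h.
  by apply: mulr_ge0; [rewrite invr_ge0|rewrite subr_ge0; apply: hphi; rewrite lerDr].
by apply: mulr_le0; [rewrite invr_le0 ltW|rewrite subr_le0; apply: hphi; rewrite gerDr ltW].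
Unshelve. all: by end_near. Qed.

(** B^t can be made as small as desired: if x > 0, the choice B^t = x / (K + 1) is contradictory. *)
Lemma le0_of_le_powR x (K t : R) : 0 < t -> 0 <= K ->
  (forall B, 0 < B -> x <= K * B `^ t) -> x <= 0.
Proof.
move=> t0 K0 H; rewrite leNgt; apply/negP => x0.
have K1 : 0 < K + 1 by rewrite ltr_wpDl.
pose y := x / (K + 1); have y0 : 0 < y by rewrite divr_gt0.
have xy : x = y * (K + 1) by rewrite /y divfK// lt0r_neq0.
have := H _ (powR_gt0 t^-1 y0).
rewrite -powRrM mulVf ?(lt0r_neq0 t0)// (powRr1 (ltW y0)) xy; nra.
Qed.

(* [taylor_remainder_param] at B = (phi b - phi a) / (b - a), or at every B > 0 if
   this quotient is 0. *)
Lemma taylor_remainder (phi : R -> R) (M theta : R) :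
  C2 phi -> {homo phi : s t / s <= t} -> 0 < M -> 0 < theta < 1 ->
  (forall s, `|derive1n 2 phi s| <= M * (derive1 phi s) `^ theta) ->
  forall a b,
  `|phi b - phi a - derive1 phi a * (b - a)| <=
    M * ((1 - theta) / (2 - theta)) `^ (1 - theta) *
    (`|b - a| `^ (2 * (1 - theta)) * ((phi b - phi a) * (b - a)) `^ theta).
Proof.
move=> [dphi ddphi _] incr M0 th hM a b.
have phi'0 := nondecreasing_derive1_ge0 incr dphi.
have [th0 th1] := andP th.
have [->|ba] := eqVneq b a.
  by rewrite !subrr mulr0 subr0 normr0 mulr_ge0 ?mulr_ge0 ?powR_ge0 ?ltW.
set v := b - a; have v0 : v != 0 by rewrite subr_eq0.
have bE : b = a + v by rewrite /v addrC subrK.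
have H B : 0 < B -> (phi b - phi a) / v <= B ->
    `|phi b - phi a - derive1 phi a * v| <=
    M * v ^+ 2 * (((1 - theta) / (2 - theta)) `^ (1 - theta) * B `^ theta).
  by move=> B0 hB; rewrite bE in hB *; exact: taylor_remainder_param.
set c := ((1 - theta) / _) `^ _ in H *; have c0 : 0 <= c by exact: powR_ge0.
have D0 : 0 <= (phi b - phi a) / v.
  have [ab|ba'] := leP a b.
    by rewrite divr_ge0// subr_ge0//; exact: incr.
  rewrite -mulrNN -invrN; apply: mulr_ge0.
    by rewrite oppr_ge0 subr_le0; apply: incr; exact: ltW.
  by rewrite invr_ge0 oppr_ge0 subr_le0 ltW.
set D := (phi b - phi a) / v in H D0 *.
(* Writing v^2 D^theta as |v|^(2 (1 - theta)) (D v^2)^theta produces the product whose integral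
   occurs in the energy identity. *)
have DvE : (phi b - phi a) * v = D * `|v| ^+ 2.
  by rewrite real_normK ?num_real// /D expr2 mulrA divfK.
move: D0; rewrite le_eqVlt => /orP[/eqP D0|D0].
  have : `|phi b - phi a - derive1 phi a * v| <= 0.
    apply: (@le0_of_le_powR _ (M * v ^+ 2 * c) theta) => //.
      exact: (mulr_ge0 (mulr_ge0 (ltW M0) (sqr_ge0 v)) c0).
    by move=> B B0; rewrite -[leRHS]mulrA; apply: H; rewrite // -D0 ltW.
  move/le_trans; apply.
  exact: (mulr_ge0 (mulr_ge0 (ltW M0) c0) (mulr_ge0 (powR_ge0 _ _) (powR_ge0 _ _))).
apply: le_trans (H D D0 (lexx _)) _.
have v1 : 0 < `|v| by rewrite normr_gt0.
rewrite DvE powRM ?sqr_ge0 ?(ltW D0)// -(real_normK (num_real v)) -(powR_mulrn 2 (ltW v1)) -powRrM.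
rewrite [X in M * X * _](_ : _ = `|v| `^ (2 * (1 - theta)) * `|v| `^ (2 * theta)); last first.
  rewrite -powRD; last by apply/implyP => _; rewrite gt_eqF.
  by congr powR; ring.
by rewrite le_eqVlt; apply/orP; left; apply/eqP; ring.
Qed.

End Remainder.

(** * Hölder's inequality with three factors *)

Section Hoelder3.
Context d (T : measurableType d) {R : realType} (mu : {measure set T -> \bar R}).
Variables (D : set T) (mD : measurable D).
Implicit Types (f g h w : T -> R).

Lemma Rintegral_eq0_ae f : mu.-integrable D (EFin \o f) -> (forall x, D x -> 0 <= f x) ->
  \int[mu]_(x in D) f x = 0 -> {ae mu, forall x, D x -> f x = 0}.
Proof.
move=> fi f0 If0.
have : (\int[mu]_(x in D) `|(f x)%:E| = 0)%E.
  rewrite (eq_integral (EFin \o f)); last first.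
    by move=> x; rewrite inE => Dx; rewrite /= ger0_norm// f0.
  by apply/eqP; rewrite -fine_eq0 ?integrable_fin_num//; apply/eqP.
have mf : measurable_fun D (EFin \o f) by case/integrableP : fi.
move=> /(ae_eq_integral_abs mu mD mf); apply: filterS => x + Dx => /(_ Dx) [].
exact.
Qed.

Lemma Rintegral_ae0 w : measurable_fun D w -> {ae mu, forall x, D x -> w x = 0} ->
  \int[mu]_(x in D) w x = 0.
Proof.
move=> mw w0; rewrite /Rintegral (ae_eq_integral (cst 0%E))//.
- by rewrite integral0.
- exact/measurable_EFinP.
- by apply: filterS w0 => x + Dx => /(_ Dx) /= ->.
Qed.

(** The functions are divided by their integrals, [amgm3] is applied pointwise, and integration
    yields a + b + c = 1. If one of the integrals is 0, that function and with it the product vanish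
    almost everywhere. *)
Lemma hoelder3 f g h a b c :
  mu.-integrable D (EFin \o f) -> mu.-integrable D (EFin \o g) -> mu.-integrable D (EFin \o h) ->
  (forall x, D x -> 0 <= f x) -> (forall x, D x -> 0 <= g x) -> (forall x, D x -> 0 <= h x) ->
  0 < a -> 0 < b -> 0 < c -> a + b + c = 1 ->
  mu.-integrable D (EFin \o (fun x => f x `^ a * g x `^ b * h x `^ c)) /\
  \int[mu]_(x in D) (f x `^ a * g x `^ b * h x `^ c) <=
    (\int[mu]_(x in D) f x) `^ a * (\int[mu]_(x in D) g x) `^ b * (\int[mu]_(x in D) h x) `^ c.
Proof.
move=> fi gi hi f0 g0 h0 a0 b0 c0 abc.
have pd (y Y e : R) : 0 <= y -> 0 < Y -> (y / Y) `^ e = y `^ e / Y `^ e.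
  by move=> y0 Y0; rewrite (@powRM _ y) ?invr_ge0 ?(ltW Y0)// -(powR_inv1 (ltW Y0)) -powRrM mulN1r powRN.
have weights (k F G H : R) : F != 0 -> G != 0 -> H != 0 ->
    k * (a / F) * F + k * (b / G) * G + k * (c / H) * H = k.
  move=> F0 G0 H0; transitivity (k * (a + b + c)); last by rewrite abc mulr1.
  by field; rewrite F0 G0 H0.
have normalize (x y z F G H : R) : F != 0 -> G != 0 -> H != 0 ->
    x / F * (y / G) * (z / H) = x * y * z / (F * G * H).
  by move=> F0 G0 H0; field; rewrite F0 G0 H0.
have mE u : mu.-integrable D (EFin \o u) -> measurable_fun D u.
  by move=> /integrableP[/measurable_EFinP].
have mP (u : T -> R) e : measurable_fun D u -> measurable_fun D (fun x => u x `^ e).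
  by move=> mu'; apply: (measurableT_comp (measurable_powR _)).
set w := fun x => _.
have mw : measurable_fun D w.
  by do 2?[apply: measurable_funM]; apply: mP; exact: mE.
have w0 x : 0 <= w x by rewrite !mulr_ge0 ?powR_ge0.
have lin (k1 k2 k3 : R) : mu.-integrable D (EFin \o (fun x => k1 * f x + k2 * g x + k3 * h x)).
  have := integrableD mD (integrableD mD (integrableZl mD k1 fi) (integrableZl mD k2 gi)) (integrableZl mD k3 hi).
  by apply: eq_integrable.
have wi : mu.-integrable D (EFin \o w).
  apply: le_integrable (lin a b c) => //; first exact/measurable_EFinP.
  move=> x Dx /=; rewrite lee_fin !ger0_norm ?w0//.
    by apply: amgm3; rewrite ?f0 ?g0 ?h0.
  by rewrite !addr_ge0 ?mulr_ge0 ?f0 ?g0 ?h0 ?ltW.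
split => //.
set F := \int[mu]_(x in D) f x; set G := \int[mu]_(x in D) g x; set H := \int[mu]_(x in D) h x.
have F0 : 0 <= F by exact: Rintegral_ge0. have G0 : 0 <= G by exact: Rintegral_ge0.
have H0 : 0 <= H by exact: Rintegral_ge0.
have zero u : mu.-integrable D (EFin \o u) -> (forall x, D x -> 0 <= u x) ->
    (forall x, u x = 0 -> w x = 0) -> \int[mu]_(x in D) u x = 0 ->
    \int[mu]_(x in D) w x <= F `^ a * G `^ b * H `^ c.
  move=> ui u0 uw Iu; rewrite Rintegral_ae0 ?mulr_ge0 ?powR_ge0//.
  by apply: filterS (Rintegral_eq0_ae ui u0 Iu) => x + Dx => /(_ Dx) /uw.
have an0 := lt0r_neq0 a0; have bn0 := lt0r_neq0 b0; have cn0 := lt0r_neq0 c0.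
have [F0'|F0'] := eqVneq F 0.
  by apply: (zero f) => // x fx; rewrite /w fx powR0// !mul0r.
have [G0'|G0'] := eqVneq G 0.
  by apply: (zero g) => // x gx; rewrite /w gx powR0// mulr0 mul0r.
have [H0'|H0'] := eqVneq H 0.
  by apply: (zero h) => // x hx; rewrite /w hx powR0// mulr0.
have Fp : 0 < F by rewrite lt_def F0'. have Gp : 0 < G by rewrite lt_def G0'.
have Hp : 0 < H by rewrite lt_def H0'.
set K := F `^ a * G `^ b * H `^ c.
have K0 : 0 < K by rewrite !mulr_gt0 ?powR_gt0.
apply: (@le_trans _ _ (\int[mu]_(x in D) (K * (a / F) * f x + K * (b / G) * g x + K * (c / H) * h x))).
  apply: le_Rintegral => // x Dx.
  have := @amgm3 _ a b c (f x / F) (g x / G) (h x / H) a0 b0 c0 abc.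
  rewrite !divr_ge0 ?f0 ?g0 ?h0// => /(_ isT isT isT).
  rewrite (pd _ _ _ (f0 _ Dx) Fp) (pd _ _ _ (g0 _ Dx) Gp) (pd _ _ _ (h0 _ Dx) Hp).
  have e := normalize (f x `^ a) (g x `^ b) (h x `^ c) _ _ _ (lt0r_neq0 (powR_gt0 a Fp))
    (lt0r_neq0 (powR_gt0 b Gp)) (lt0r_neq0 (powR_gt0 c Hp)).
  rewrite e (ler_pdivrMr _ _ K0) => /le_trans; apply.
  by rewrite le_eqVlt; apply/orP; left; apply/eqP; ring.
have I1 := integrableZl mD (K * (a / F)) fi.
have I2 := integrableZl mD (K * (b / G)) gi.
have I3 := integrableZl mD (K * (c / H)) hi.
rewrite RintegralD//; last exact: (integrableD mD I1 I2).
rewrite RintegralD// !RintegralZl//.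
rewrite (weights K F G H F0' G0' H0').
exact: lexx.
Qed.

End Hoelder3.

(** * The constant eta *)

Section Constants.
Context {R : realType}.
Variables (r : R) (r1 : 1 < r).
Let q := q_ r.
Let rh := rho r.
Let th := 1 / r.

Let r0 : 0 < r. Proof. exact: lt_trans r1. Qed.
Let r10 : 0 < r - 1. Proof. by rewrite subr_gt0. Qed.

Let r32 : 0 < 3 * r - 2. Proof. by have := r1; lra. Qed.

Lemma q_gt2 : 2 < q_ r.
Proof. rewrite /q_ ltr_pdivlMr//; have := r1; lra. Qed.

Let q0 : 0 < q. Proof. exact: lt_trans q_gt2. Qed.

Lemma theta_in01 : 0 < 1 / r < 1.
Proof. by rewrite divr_gt0//= ltr_pdivrMr// mul1r. Qed.

Lemma rhoE : rho r = 1 / q_ r + 1 / r.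
Proof. by rewrite /rho -/q; field; rewrite !lt0r_neq0. Qed.

Let iq0 : 0 < 1 / q. Proof. by rewrite divr_gt0. Qed.
Let th0 : 0 < th. Proof. by case/andP: theta_in01. Qed.

Lemma rho_gt0 : 0 < rho r.
Proof. by rewrite rhoE addr_gt0. Qed.

(** The power of |v|_2 that Gagliardo-Nirenberg leaves after raising |v|_q to 2 (1 - 1/r);
    [exponent_A] is that of |grad v|_2, where the factor 2 absorbs the square root of the Dirichlet
    integral. *)
Lemma exponent_N : 4 * (1 - 1 / r) / q_ r = 2 - 2 * rho r.
Proof. by rewrite rhoE /q_; field; rewrite !lt0r_neq0. Qed.

Lemma exponent_A : (q_ r - 2) / q_ r * (2 * (1 - 1 / r)) = 2 * (1 / q_ r).
Proof. by rewrite /q_; field; rewrite !lt0r_neq0. Qed.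

Lemma exponent_sum : 1 / q_ r + 2 * (1 - 1 / r) / q_ r + 1 / r = 1.
Proof. by rewrite /q_; field; rewrite !lt0r_neq0. Qed.

Lemma rho_lt1 : rho r < 1.
Proof.
have := exponent_sum; rewrite rhoE => e.
have : 0 < 2 * (1 - 1 / r) / q_ r.
  by rewrite divr_gt0// mulr_gt0// subr_gt0; case/andP: theta_in01.
by lra.
Qed.

Let rh0 : 0 < rh. Proof. exact: rho_gt0. Qed.
Let rh2 : 0 < 2 - rh. Proof. by have := rho_lt1; rewrite /rh; lra. Qed.

(** Weighted mean inequality with weights (1/q)/rho and (1/r)/rho, raised to the power rho. The
    reciprocals of the weights, q rho and r rho, are the source of q^(1/q) r^(1/r) rho^rho. *)
Lemma young_AB (A B : R) : 0 <= A -> 0 <= B ->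
  A `^ (1 / q) * B `^ th * (q `^ (1 / q) * r `^ th * rh `^ rh) <= (A + B) `^ rh.
Proof.
move=> A0 B0; pose t := 1 / q / rh.
have e1 : 1 - t = th / rh by rewrite /t /th /rh rhoE -/q; field; rewrite !lt0r_neq0// addr_gt0.
have t01 : 0 < t < 1.
  have := divr_gt0 th0 rh0; rewrite -e1 subr_gt0 => ->.
  by rewrite andbT divr_gt0.
have t0 : 0 < t by case/andP: t01.
have u0 : 0 < 1 - t by rewrite e1 divr_gt0.
have := @amgm2 _ t (A / t) (B / (1 - t)) t01 (divr_ge0 A0 (ltW t0)) (divr_ge0 B0 (ltW u0)).
rewrite [leRHS](_ : _ = A + B); last by field; rewrite !lt0r_neq0.
move=> H; have := @ge0_ler_powR _ rh (ltW rh0) _ _ _ _ H.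
rewrite !nnegrE mulr_ge0 ?powR_ge0// addr_ge0// => /(_ isT isT).
rewrite (powRM _ (powR_ge0 _ _) (powR_ge0 _ _)) -!powRrM (_ : t * rh = 1 / q); last by rewrite /t divfK ?lt0r_neq0.
rewrite (_ : (1 - t) * rh = th); last by rewrite e1 divfK ?lt0r_neq0.
rewrite (_ : A / t = A * (q * rh)); last by rewrite /t; field; rewrite !lt0r_neq0.
rewrite (_ : B / (1 - t) = B * (r * rh)); last by rewrite e1 /th; field; rewrite !lt0r_neq0.
rewrite (powRM _ A0 (mulr_ge0 (ltW q0) (ltW rh0))) (powRM _ B0 (mulr_ge0 (ltW r0) (ltW rh0))).
rewrite (powRM _ (ltW q0) (ltW rh0)) (powRM _ (ltW r0) (ltW rh0)).
have -> : rh `^ rh = rh `^ (1 / q) * rh `^ th.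
  rewrite -powRD; last by apply/implyP => _; rewrite lt0r_neq0.
  by rewrite {2}/rh rhoE.
by apply: le_trans; rewrite le_eqVlt; apply/orP; left; apply/eqP; ring.
Qed.

(** Young with weights rho/2 and 1 - rho/2, applied to alpha W^2 / rho and N^2 / (2 - rho) so that
    the right-hand side is exactly the quadratic part of the cost. Here rho^(- rho/2) arises, which
    reduces the rho^rho of [young_AB] to the rho^(rho/2) in [eta_]. *)
Lemma young_WN (alpha W N : R) : 0 < alpha -> 0 <= W -> 0 <= N ->
  alpha `^ (rh / 2) * W `^ rh * N `^ (2 - rh) * (rh `^ (- (rh / 2)) * (2 - rh) `^ (rh / 2 - 1)) <=
  alpha / 2 * W ^+ 2 + 2^-1 * N ^+ 2.
Proof.
move=> a0 W0 N0; pose t := rh / 2.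
have t01 : 0 < t < 1 by rewrite /t divr_gt0//=; have := rh2; lra.
have aW0 : 0 <= alpha * W ^+ 2 by rewrite mulr_ge0 ?sqr_ge0 ?(ltW a0).
have := @amgm2 _ t (alpha * W ^+ 2 / rh) (N ^+ 2 / (2 - rh)) t01
  (divr_ge0 aW0 (ltW rh0)) (divr_ge0 (sqr_ge0 N) (ltW rh2)).
rewrite [leRHS](_ : _ = alpha / 2 * W ^+ 2 + 2^-1 * N ^+ 2); last first.
  by rewrite /t; field; rewrite !lt0r_neq0.
apply: le_trans; rewrite le_eqVlt; apply/orP; left; apply/eqP.
have pd (y Y e : R) : 0 <= y -> 0 < Y -> (y / Y) `^ e = y `^ e * Y `^ (- e).
  by move=> y0 Y0; rewrite (@powRM _ y) ?invr_ge0 ?(ltW Y0)// -(powR_inv1 (ltW Y0)) -powRrM mulN1r.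
rewrite (pd _ _ _ aW0 rh0) (pd _ _ _ (sqr_ge0 N) rh2) (powRM _ (ltW a0) (sqr_ge0 W)).
rewrite -(powR_mulrn 2 W0) -(powR_mulrn 2 N0) -!powRrM.
rewrite (_ : 2 * t = rh); last by rewrite /t; field.
rewrite (_ : 2 * (1 - t) = 2 - rh); last by rewrite /t; field.
rewrite (_ : - (1 - t) = rh / 2 - 1); last by rewrite /t; ring.
by rewrite /t; ring.
Qed.

(** In the application P and V are the L^q norms of the adjoint state and of v, N and W the L^2
    norms of v and w, A is the squared norm of grad v, B the integral of (phi(y) - phi(ybar)) v and
    E the integral of the adjoint state times the remainder. *)
Lemma optimality_bound (M Cq alpha P V N W A B E : R) :
  0 < M -> 0 < Cq -> 0 < alpha -> 0 <= P -> 0 <= V -> 0 <= N -> 0 <= W -> 0 <= A -> 0 <= B ->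
  E <= M * ((1 - 1 / r) / (2 - 1 / r)) `^ (1 - 1 / r) * (P * V `^ (2 * (1 - 1 / r)) * B `^ (1 / r)) ->
  V <= Cq * N `^ (2 / q_ r) * Num.sqrt A `^ ((q_ r - 2) / q_ r) ->
  A + B <= W * N ->
  E * eta_ alpha r Cq M <= P * (alpha / 2 * W ^+ 2 + 2^-1 * N ^+ 2).
Proof.
move=> M0 C0 a0 P0 V0 N0 W0 A0 B0 hE hV hAB.
rewrite -/th -/q in hE hV *.
have u0 : 0 < 1 - th by rewrite subr_gt0; case/andP: theta_in01.
have c2 : 0 < 2 * (1 - th) by rewrite mulr_gt0.
have bE : (r - 1) / (2 * r - 1) = (1 - th) / (2 - th).
  have r21 : 0 < 2 * r - 1 by have := r1; lra.
  rewrite /th; field. by rewrite !lt0r_neq0.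
have b0 : 0 < (1 - th) / (2 - th).
  by rewrite divr_gt0//; have := u0; lra.
set c := ((1 - th) / _) `^ (1 - th) in hE *; have c0 : 0 < c by exact: powR_gt0.
have VE : V `^ (2 * (1 - th)) <= Cq `^ (2 * (1 - th)) * N `^ (2 - 2 * rh) * A `^ (1 / q).
  have n1 := mulr_ge0 (ltW C0) (powR_ge0 N (2 / q)).
  have n2 := powR_ge0 (Num.sqrt A) ((q - 2) / q).
  apply: (@le_trans _ _ ((Cq * N `^ (2 / q) * Num.sqrt A `^ ((q - 2) / q)) `^ (2 * (1 - th)))).
    by apply: (ge0_ler_powR (ltW c2)); rewrite ?nnegrE//; exact: mulr_ge0.
  rewrite (powRM _ n1 n2) (powRM _ (ltW C0) (powR_ge0 _ _)) -!powRrM exponent_A.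
  rewrite (_ : 2 / q * (2 * (1 - th)) = 2 - 2 * rh); last first.
    by rewrite -exponent_N -/q -/th; field; rewrite lt0r_neq0.
  by rewrite [Num.sqrt A `^ _]powRrM powR_mulrn ?sqrtr_ge0// sqr_sqrtr.
have etaE : eta_ alpha r Cq M = alpha `^ (rh / 2) * (Cq `^ (2 * (1 - th)))^-1 * M^-1 * c^-1 *
    q `^ (1 / q) * r `^ th * rh `^ (rh / 2) * (2 - rh) `^ (rh / 2 - 1).
  rewrite /eta_ bE (_ : (1 - r) / r = - (1 - th)); last by rewrite /th; field; rewrite lt0r_neq0.
  rewrite powRN -/c (_ : (2 - 2 * r) / r = - (2 * (1 - th))); last by rewrite /th; field; rewrite lt0r_neq0.
  by rewrite powRN.
have CqP : 0 < Cq `^ (2 * (1 - th)) by exact: powR_gt0.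
have eta0 : 0 < eta_ alpha r Cq M.
  by rewrite etaE !mulr_gt0 ?invr_gt0 ?powR_gt0.
pose X := A `^ (1 / q) * B `^ th * (q `^ (1 / q) * r `^ th * rh `^ rh).
pose Z := alpha `^ (rh / 2) * (rh `^ (- (rh / 2)) * (2 - rh) `^ (rh / 2 - 1)).
have Z0 : 0 <= Z by rewrite !mulr_ge0 ?powR_ge0.
apply: (@le_trans _ _ (P * (N `^ (2 - 2 * rh) * Z * X))).
  apply: le_trans (ler_wpM2r (ltW eta0) hE) _.
  apply: (@le_trans _ _ (M * c * (P * (Cq `^ (2 * (1 - th)) * N `^ (2 - 2 * rh) * A `^ (1 / q)) * B `^ th) * eta_ alpha r Cq M)).
    apply: ler_wpM2r; first exact: ltW.
    apply: ler_wpM2l; first by rewrite mulr_ge0 ?(ltW M0) ?(ltW c0).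
    apply: ler_wpM2r; first exact: powR_ge0.
    exact: ler_wpM2l.
  rewrite le_eqVlt; apply/orP; left; apply/eqP; rewrite etaE /X /Z.
  have -> : rh `^ (- (rh / 2)) = rh `^ (rh / 2) * (rh `^ rh)^-1.
    rewrite -powRN -powRD; last by apply/implyP => _; rewrite lt0r_neq0.
    by congr powR; field.
  have rp : rh `^ rh != 0 by rewrite lt0r_neq0// powR_gt0.
  field; by rewrite rp !lt0r_neq0.
apply: ler_wpM2l => //.
have XW : X <= W `^ rh * N `^ rh.
  apply: le_trans (young_AB A0 B0) _; rewrite -powRM//.
  by apply: (ge0_ler_powR (ltW rh0)); rewrite ?nnegrE//; [exact: addr_ge0|exact: mulr_ge0].
apply: le_trans (young_WN a0 W0 N0).
apply: le_trans (ler_wpM2l _ XW) _; first by apply: mulr_ge0 => //; exact: powR_ge0.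
rewrite le_eqVlt; apply/orP; left; apply/eqP.
(* Splitting a power of N into two requires a nonzero base; for N = 0 both sides vanish since the
   exponents 2 - 2 rho and 2 - rho are positive. *)
have [->|Nn0] := eqVneq N 0.
  by rewrite !powR0 ?mulr0 ?mul0r// ?lt0r_neq0//; have := rho_lt1; rewrite -/rh; lra.
have -> : N `^ (2 - rh) = N `^ (2 - 2 * rh) * N `^ rh.
  by rewrite -powRD; [congr powR; ring|apply/implyP].
by rewrite /Z; ring.
Qed.

Lemma eta_gt0 (alpha M Cq : R) : 0 < alpha -> 0 < M -> 0 < Cq -> 0 < eta_ alpha r Cq M.
Proof.
move=> a0 M0 C0.
have d0 : 0 < 2 * r - 1 by have := r1; lra.
have b0 := divr_gt0 r10 d0.
by rewrite /eta_ !mulr_gt0 ?invr_gt0//; apply: powR_gt0.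
Qed.

End Constants.

(** * The state equation *)

Section ClosureL2.
Context {R : realType}.
Local Notation mu := (@leb2 R).
Variables (Omega : set (plane R)) (oO : open Omega) (bO : bounded_set Omega).
Implicit Types (f g u v w y : plane R -> R).

Let mO : measurable Omega := open_measurable2 oO.

(** Continuity up to the boundary gives boundedness, so [phi \o y] is in L2 without any growth
    condition on [phi]. *)
Lemma continuous_closure_L2 f : {within closure Omega, continuous f} -> L2 Omega f.
Proof.
move=> cf; have [C HC] := continuous_closure_bounded bO cf.
apply: (L2_bounded mO (bounded_leb2_lty mO bO) _ HC).
apply: (@measurable_funS _ _ _ _ (closure Omega)).
- rewrite -[X in measurable X]setCK; apply: measurableC; apply: open_measurable2.
  by apply: closed_openC; exact: closed_closure.
- exact: subset_closure.
- exact: within_continuous_measurable2.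
Qed.

Lemma within_continuous_comp (phi : R -> R) f : continuous phi ->
  {within closure Omega, continuous f} -> {within closure Omega, continuous (phi \o f)}.
Proof. by move=> cp cf x; apply: (cvg_comp _ _ (cf x)); exact: cp. Qed.

Lemma normL_powR f (q : R) : 0 < q -> L2 Omega f -> (normL Omega q f < +oo)%E ->
  mu.-integrable Omega (EFin \o (fun x => `|f x| `^ q)) /\
  fine (normL Omega q f) = (\int[mu]_(x in Omega) (`|f x| `^ q)) `^ (1 / q).
Proof.
move=> q0 fL fin; have q1 := lt0r_neq0 q0.
have N0 : (0 <= normL Omega q f)%E by exact: Lnorm_ge0.
have finN : normL Omega q f \is a fin_num by rewrite ge0_fin_numE.
have mf := L2_measurable oO fL.
have E : (\int[mu]_(x in Omega) (`|f x| `^ q)%:E = (fine (normL Omega q f) `^ q)%:E)%E.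
  rewrite -poweR_EFin (fineK finN).
  apply: (etrans _ (esym (poweR_Lnorm mu (EFin \o (f \_ Omega)) q1))).
  rewrite [LHS]integral_mkcond.
  apply: eq_integral => x _ /=; have [xO|xO] := boolP (x \in Omega).
    by rewrite !(patchT _ _ xO).
  by rewrite !(patchN _ _ xO) normr0 powR0.
have mp : measurable_fun Omega (fun x => `|f x| `^ q).
  by apply: (measurableT_comp (measurable_powR _)); apply: measurableT_comp.
split.
  apply/integrableP; split; first exact/measurable_EFinP.
  under eq_integral do rewrite /= ger0_norm ?powR_ge0//.
  by rewrite E ltry.
by rewrite /Rintegral E /= -powRrM mul1r mulfV// powRr1// fine_ge0.
Qed.

End ClosureL2.

Section StateEquation.
Context {R : realType}.
Local Notation mu := (@leb2 R).
Variables (Omega : set (plane R)) (oO : open Omega) (bO : bounded_set Omega).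
Variables (phi : R -> R) (cphi : continuous phi) (phi_incr : {homo phi : s t / s <= t}).
Implicit Types (f g u v w y : plane R -> R).

Let mO : measurable Omega := open_measurable2 oO.

Lemma Rintegral_grad_dotBl f g w : H1 Omega f -> H1 Omega g -> H1 Omega w ->
  \int[mu]_(x in Omega) grad_dot Omega (f \- g) w x =
  \int[mu]_(x in Omega) grad_dot Omega f w x - \int[mu]_(x in Omega) grad_dot Omega g w x.
Proof.
move=> fH gH wH.
have I1 := grad_dot_integrable mO fH wH.
have I2 := grad_dot_integrable mO gH wH.
have I3 := grad_dot_integrable mO (H1B oO fH gH) wH.
apply: (etrans _ (RintegralB mO I1 I2)).
apply: (ae_eq_Rintegral oO).
- by apply/measurable_EFinP; case/integrableP: I3.
- by apply: measurable_funB; apply/measurable_EFinP; [case/integrableP: I1|case/integrableP: I2].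
- apply: filterS2 (wpartialB oO true fH gH) (wpartialB oO false fH gH) => x h1 h0 Ox.
  have lin (a b a1 b1 c d a' b' : R) : a' = a - a1 -> b' = b - b1 ->
      a' * c + b' * d = (a * c + b * d) - (a1 * c + b1 * d) by move=> -> ->; ring.
  apply: (etrans (grad_dotE _ _ _ _)).
  apply: (etrans (lin _ _ _ _ _ _ _ _ (h1 Ox) (h0 Ox))).
  by congr (_ - _); apply: esym; exact: grad_dotE.
Qed.

Lemma state_equation_weak u y v : L2 Omega u -> state_equation Omega phi u y ->
  H10 Omega v ->
  \int[mu]_(x in Omega) grad_dot Omega y v x =
  \int[mu]_(x in Omega) ((u x - phi (y x)) * v x).
Proof.
move=> uL [[yH10 yH2 cy] eqy] vH; have vL : L2 Omega v by case: vH => -[].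
have pL : L2 Omega (phi \o y) by apply: continuous_closure_L2 => //; exact: within_continuous_comp.
have lL := laplacian_L2 yH2.
apply: oppr_inj; apply: (etrans (esym (Green oO yH2 vH))).
have NL := L2N (L2B uL pL).
apply: (@etrans _ _ (\int[mu]_(x in Omega) (- (u x - phi (y x)) * v x))).
  apply: (ae_eq_Rintegral oO).
  - by apply: measurable_funM; [exact: (L2_measurable oO lL)|exact: (L2_measurable oO vL)].
  - by apply: measurable_funM; [exact: (L2_measurable oO NL)|exact: (L2_measurable oO vL)].
  - apply: filterS eqy => x + Ox => /(_ Ox) <-; congr (_ * _).
    by move: (laplacian _ _ _) (phi _) => l p; ring.
have I := L2_mul mO (L2B uL pL) vL.
have := RintegralZl (-1) mO I; rewrite mulN1r => <-.
by apply: eq_Rintegral => x _; rewrite mulNr mulN1r.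
Qed.

Lemma monotone_product_ge0 a b : 0 <= (phi b - phi a) * (b - a).
Proof.
have [ab|ba] := leP a b.
  by rewrite mulr_ge0 ?subr_ge0// phi_incr.
by rewrite -mulrNN !opprB mulr_ge0 ?subr_ge0 ?(ltW ba)// phi_incr// ltW.
Qed.

Lemma state_equation_unique (q C : R) u y y1 : 2 < q -> 0 <= C ->
  (GN_optimal_constant q <= C%:E)%E ->
  L2 Omega u -> state_equation Omega phi u y1 ->
  H10 Omega y -> {within closure Omega, continuous y} ->
  (forall v, H10 Omega v ->
    \int[mu]_(x in Omega) (grad_dot Omega y v x + phi (y x) * v x) =
    \int[mu]_(x in Omega) (u x * v x)) ->
  forall x, closure Omega x -> y x = y1 x.
Proof.
have le_lin (g i1 i2 i3 : R) : g = (i1 - i2) - (i1 - i3) -> 0 <= i2 - i3 -> g <= 0 by lra.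
move=> q2 C0 GNC uL sy1 yH cy Hy.
have [[y1H10 y1H2 cy1] _] := sy1.
pose v := y \- y1.
have vH : H10 Omega v by exact: H10B.
have vL : L2 Omega v by case: vH => -[].
have yH1 := H10_H1 yH; have y1H1 := H10_H1 y1H10; have vH1 := H10_H1 vH.
have pL : L2 Omega (phi \o y) by apply: continuous_closure_L2 => //; exact: within_continuous_comp.
have pL1 : L2 Omega (phi \o y1) by apply: continuous_closure_L2 => //; exact: within_continuous_comp.
have I1 := grad_dot_integrable mO yH1 vH1.
have I2 := grad_dot_integrable mO y1H1 vH1.
have I3 := L2_mul mO pL vL. have I4 := L2_mul mO pL1 vL. have I5 := L2_mul mO uL vL.
have gv := Rintegral_grad_dotBl yH1 y1H1 vH1.
have e1 : \int[mu]_(x in Omega) grad_dot Omega y v x =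
    \int[mu]_(x in Omega) (u x * v x) - \int[mu]_(x in Omega) (phi (y x) * v x).
  apply/eqP; rewrite eq_sym subr_eq; apply/eqP; rewrite -(Hy _ vH).
  exact: (RintegralD mO I1 I3).
have e2 : \int[mu]_(x in Omega) grad_dot Omega y1 v x =
    \int[mu]_(x in Omega) (u x * v x) - \int[mu]_(x in Omega) (phi (y1 x) * v x).
  apply: (etrans (state_equation_weak uL sy1 vH)).
  apply: (etrans _ (RintegralB mO I5 I4)).
  by apply: eq_Rintegral => x _; rewrite /= mulrBl.
have gB : \int[mu]_(x in Omega) ((phi (y x) - phi (y1 x)) * v x) =
    \int[mu]_(x in Omega) (phi (y x) * v x) - \int[mu]_(x in Omega) (phi (y1 x) * v x).
  apply: (etrans _ (RintegralB mO I3 I4)).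
  by apply: eq_Rintegral => x _; rewrite /= mulrBl.
have B0 : 0 <= \int[mu]_(x in Omega) ((phi (y x) - phi (y1 x)) * v x).
  by apply: Rintegral_ge0 => x _; exact: monotone_product_ge0.
have A0 : 0 <= \int[mu]_(x in Omega) grad_dot Omega v v x.
  by apply: Rintegral_ge0 => x _; exact: grad_dot_ge0.
have Av : \int[mu]_(x in Omega) grad_dot Omega v v x = 0.
  apply/eqP; rewrite eq_le A0 andbT.
  apply: (le_lin _ _ _ _ (etrans gv (congr2 (fun a b => a - b) e1 e2))).
  by move: B0; rewrite [X in 0 <= X -> _]gB.
have q0 : 0 < q by apply: lt_trans q2.
(* The exponent (q - 2)/q of the gradient norm is positive, so a vanishing gradient annihilates the
   right-hand side. *)
have := GN_H10 oO q2 C0 GNC vH.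
rewrite Av sqrtr0 powR0 ?mulr0; last by rewrite lt0r_neq0// divr_gt0// subr_gt0.
move=> vq; have vq0 : normL Omega q v = 0%E by apply/eqP; rewrite eq_le vq/= Lnorm_ge0.
have vae : v = cst 0 %[ae mu in Omega].
  have mv : measurable_fun setT (EFin \o (v \_ Omega)).
    by apply/measurable_EFinP/(measurable_restrictT _ mO); exact: (L2_measurable oO vL).
  have := Lnorm_eq0_eq0 mv _ vq0; rewrite lte_fin => /(_ q0).
  apply: filterS => x /(_ I) /= [] + Ox.
  by rewrite patchT ?inE.
have cv : {within closure Omega, continuous v}.
  by move=> x; apply: cvgB; [exact: cy|exact: cy1].
move=> x Ox; apply/eqP; rewrite -subr_eq0; apply/eqP.
exact: (continuous_ae_eq0 oO cv vae Ox).
Qed.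

(** The variational equation for [ybar] provides no second derivatives. They are inherited from
    [G ubar]: functions equal on [Omega] have identical [wpartial], by [wpartial_ae]. *)
Lemma state_equation_ext u y y1 : state_equation Omega phi u y1 ->
  H10 Omega y -> {within closure Omega, continuous y} ->
  (forall x, Omega x -> y x = y1 x) -> state_equation Omega phi u y.
Proof.
move=> [[y1H10 [y1H1 y1H2] cy1] eq1] yH cy yy1.
have yL : L2 Omega y by case: yH => -[].
have y1L : L2 Omega y1 by case: y1H1.
have W i : wpartial Omega i y = wpartial Omega i y1.
  by apply: (wpartial_ae oO) => //; apply: aeW => x; exact: yy1.
have LE : laplacian Omega y = laplacian Omega y1.
  apply/funext => x; apply: (etrans (laplacianE _ _ _)).
  by rewrite (W true) (W false); apply: esym; exact: laplacianE.
split.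
  split; [exact: yH| |exact: cy].
  split; first exact: H10_H1.
  by move=> i; rewrite (W i); exact: y1H2.
by apply: filterS eq1 => x + Ox => /(_ Ox); rewrite LE yy1.
Qed.

End StateEquation.

(** * Comparison of the cost functionals *)

Section Comparison.
Context {R : realType}.
Local Notation mu := (@leb2 R).
Variables (Omega : set (plane R)) (oO : open Omega) (bO : bounded_set Omega).
Variables (phi : R -> R) (hphi : C2 phi) (phi_incr : {homo phi : s t / s <= t}).
Variables (r M : R) (hr : 1 < r) (hM : 0 < M)
  (hphi'' : forall s, `|derive1n 2 phi s| <= M * (derive1 phi s) `^ (1 / r)).
Variables (alpha Cq : R) (halpha : 0 < alpha) (hCq : 0 < Cq)
  (hGN : (GN_optimal_constant (q_ r) <= Cq%:E)%E).
Implicit Types (f g u v w y p : plane R -> R).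

Let mO : measurable Omega := open_measurable2 oO.

Let cphi : continuous phi.
Proof.
case: hphi => dphi _ _ x; apply: differentiable_continuous.
by apply/derivable1_diffP.
Qed.

Let cphi' : continuous (derive1 phi).
Proof.
case: hphi => _ ddphi _ x; apply: differentiable_continuous.
by apply/derivable1_diffP.
Qed.

Definition taylor_rem y ybar : plane R -> R :=
  fun x => phi (y x) - phi (ybar x) - derive1 phi (ybar x) * (y x - ybar x).

Lemma sqr_normLD f g : L2 Omega f -> L2 Omega g ->
  fine (normL Omega 2 (fun x => f x + g x)) ^+ 2 =
  fine (normL Omega 2 f) ^+ 2 + 2 * \int[mu]_(x in Omega) (f x * g x) +
  fine (normL Omega 2 g) ^+ 2.
Proof.
move=> fL gL; rewrite !(sqr_normL mO)//; last exact: L2D.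
have I1 := L2_mul mO fL fL; have I2 := L2_mul mO fL gL; have I3 := L2_mul mO gL gL.
have I2' := L2_mul mO (L2Z 2 fL) gL.
rewrite -(RintegralZl 2 mO I2).
transitivity (\int[mu]_(x in Omega) ((f x * f x + 2 * f x * g x) + g x * g x)).
  by apply: eq_Rintegral => x _; ring.
rewrite (RintegralD mO (integrableD mO I1 I2') I3) (RintegralD mO I1 I2').
by congr (_ + _ + _); apply: eq_Rintegral => x _; rewrite ?expr2// mulrA.
Qed.

Lemma taylor_rem_L2 y ybar : {within closure Omega, continuous y} ->
  {within closure Omega, continuous ybar} -> L2 Omega (taylor_rem y ybar).
Proof.
move=> cy cyb; apply: (continuous_closure_L2 oO bO) => x.
apply: cvgB; first apply: cvgB.
- exact: (within_continuous_comp cphi cy).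
- exact: (within_continuous_comp cphi cyb).
- apply: cvgM; first exact: (within_continuous_comp cphi' cyb).
  by apply: cvgB; [exact: cy|exact: cyb].
Qed.

(** Difference of the two weak state equations, tested with v itself. *)
Lemma energy_identity u ubar y ybar : L2 Omega u -> L2 Omega ubar ->
  state_equation Omega phi u y -> state_equation Omega phi ubar ybar ->
  let v := y \- ybar in
  \int[mu]_(x in Omega) grad_dot Omega v v x +
  \int[mu]_(x in Omega) ((phi (y x) - phi (ybar x)) * v x) =
  \int[mu]_(x in Omega) ((u x - ubar x) * v x).
Proof.
have lin (a b c d g : R) : g = (a - b) - (c - d) -> g + (b - d) = a - c by move=> ->; ring.
move=> uL ubL sy syb v.
have [[yH10 yH2 cy] _] := sy; have [[ybH10 ybH2 cyb] _] := syb.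
have vH : H10 Omega v by exact: H10B.
have vL : L2 Omega v by case: vH => -[].
have pL : L2 Omega (phi \o y) by apply: continuous_closure_L2 => //; exact: within_continuous_comp.
have pbL : L2 Omega (phi \o ybar) by apply: continuous_closure_L2 => //; exact: within_continuous_comp.
have I1 := L2_mul mO uL vL; have I2 := L2_mul mO pL vL.
have I3 := L2_mul mO ubL vL; have I4 := L2_mul mO pbL vL.
have split2 f g : mu.-integrable Omega (EFin \o (fun x => f x * v x)) ->
    mu.-integrable Omega (EFin \o (fun x => g x * v x)) ->
    \int[mu]_(x in Omega) ((f x - g x) * v x) =
    \int[mu]_(x in Omega) (f x * v x) - \int[mu]_(x in Omega) (g x * v x).
  move=> If Ig; apply: (etrans _ (RintegralB mO If Ig)).
  by apply: eq_Rintegral => x _; rewrite mulrBl.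
have e1 := etrans (state_equation_weak oO bO cphi uL sy vH) (split2 _ _ I1 I2).
have e2 := etrans (state_equation_weak oO bO cphi ubL syb vH) (split2 _ _ I3 I4).
have gv := Rintegral_grad_dotBl oO (H10_H1 yH10) (H10_H1 ybH10) (H10_H1 vH).
have gv' := etrans gv (congr2 (fun a b => a - b) e1 e2).
apply: (etrans (congr2 +%R (erefl _) (split2 _ _ I2 I4))).
by apply: (etrans (lin _ _ _ _ _ gv')); apply: esym; exact: split2.
Qed.

Lemma remainder_estimate u ubar y ybar p : L2 Omega u -> L2 Omega ubar ->
  state_equation Omega phi u y -> state_equation Omega phi ubar ybar ->
  L2 Omega p -> (normL Omega (q_ r) p < +oo)%E ->
  (\int[mu]_(x in Omega) (p x * taylor_rem y ybar x)) * eta_ alpha r Cq M <=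
  fine (normL Omega (q_ r) p) *
  (alpha / 2 * fine (normL Omega 2 (u \- ubar)) ^+ 2 +
   2^-1 * fine (normL Omega 2 (y \- ybar)) ^+ 2).
Proof.
move=> uL ubL sy syb pL pfin.
have [[yH10 yH2 cy] _] := sy; have [[ybH10 ybH2 cyb] _] := syb.
set v := y \- ybar.
have vH : H10 Omega v by exact: H10B.
have vL : L2 Omega v by case: vH => -[].
have q2 := q_gt2 hr; have q0 : 0 < q_ r := lt_trans (ltr0Sn _ 1) q2.
have GNv := GN_H10 oO q2 (ltW hCq) hGN vH.
have vfin : (normL Omega (q_ r) v < +oo)%E by apply: le_lt_trans GNv _; exact: ltry.
have [Ip Pe] := normL_powR oO q0 pL pfin.
have [Iv Ve] := normL_powR oO q0 vL vfin.
have phL : L2 Omega (phi \o y) by apply: continuous_closure_L2 => //; exact: within_continuous_comp.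
have phbL : L2 Omega (phi \o ybar) by apply: continuous_closure_L2 => //; exact: within_continuous_comp.
have IB := L2_mul mO (L2B phL phbL) vL.
have th := theta_in01 hr; have [th0 th1] := andP th.
have u0 : 0 < 1 - 1 / r by rewrite subr_gt0.
have a0 : 0 < 1 / q_ r by rewrite divr_gt0.
have b0 : 0 < 2 * (1 - 1 / r) / q_ r by rewrite divr_gt0// mulr_gt0.
(* The three functions are |p|^q, |v|^q and (phi(y) - phi(ybar)) v, the last one nonnegative by
   monotonicity. *)
have [Ih Hh] := @hoelder3 _ _ _ mu _ mO _ _ _ _ _ _ Ip Iv IB
  (fun x _ => powR_ge0 _ _) (fun x _ => powR_ge0 _ _)
  (fun x _ => monotone_product_ge0 phi_incr _ _) a0 b0 th0 (exponent_sum hr).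
pose c := M * ((1 - 1 / r) / (2 - 1 / r)) `^ (1 - 1 / r).
have c0 : 0 <= c by apply: mulr_ge0; [exact: ltW|exact: powR_ge0].
apply: (@optimality_bound _ _ hr _ _ _ _ (fine (normL Omega (q_ r) v)) _ _
  (\int[mu]_(x in Omega) grad_dot Omega v v x)
  (\int[mu]_(x in Omega) ((phi (y x) - phi (ybar x)) * v x)) _ hM hCq halpha).
- by apply: fine_ge0; exact: Lnorm_ge0.
- by apply: fine_ge0; exact: Lnorm_ge0.
- by apply: fine_ge0; exact: Lnorm_ge0.
- by apply: fine_ge0; exact: Lnorm_ge0.
- by apply: Rintegral_ge0 => x _; exact: grad_dot_ge0.
- by apply: Rintegral_ge0 => x _; exact: monotone_product_ge0.
- apply: (@le_trans _ _ (c * \int[mu]_(x in Omega) ((`|p x| `^ q_ r) `^ (1 / q_ r) *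
      (`|v x| `^ q_ r) `^ (2 * (1 - 1 / r) / q_ r) *
      ((phi (y x) - phi (ybar x)) * v x) `^ (1 / r)))); last first.
    apply: ler_wpM2l => //.
    apply: le_trans Hh _; rewrite Pe Ve -powRrM.
    by rewrite (_ : 1 / q_ r * (2 * (1 - 1 / r)) = 2 * (1 - 1 / r) / q_ r)// mul1r mulrC.
  rewrite -(RintegralZl c mO Ih).
  apply: le_Rintegral => //.
  + exact: (L2_mul mO pL (taylor_rem_L2 cy cyb)).
  + exact: (integrableZl mO c Ih).
  + move=> x _; apply: le_trans (ler_norm _) _; rewrite normrM -!powRrM.
    rewrite [q_ r * _]mulrC divfK ?lt0r_neq0// powRr1//.
    rewrite [q_ r * _]mulrC divfK ?lt0r_neq0//.
    rewrite -mulrA mulrCA; apply: ler_wpM2l => //.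
    exact: taylor_remainder.
- by move: GNv; rewrite -lee_fin fineK// ge0_fin_numE// Lnorm_ge0.
- apply: le_trans (L2_CauchySchwarz mO (L2B uL ubL) vL).
  by apply: le_trans (ler_norm _); rewrite (energy_identity uL ubL sy syb).
Qed.

(** The expansion of the quadratic cost at [ubar] is exact. Inequality enters only through the signs
    given by complementarity and by the variational inequality. *)
Lemma J_lower_bound (K : set (plane R)) G y0 u ubar ybar p (mubar : {charge set (plane R) -> \bar R}) :
  L2 Omega y0 -> L2 Omega p -> L2 Omega u -> L2 Omega ubar ->
  solution_operator Omega phi G -> state_equation Omega phi ubar ybar ->
  (forall x, Omega x -> ybar x = G ubar x) ->
  (forall v, H10_H2 Omega v ->
     \int[mu]_(x in Omega)
       (p x * - laplacian Omega v x + derive1 phi (ybar x) * p x * v x) =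
     \int[mu]_(x in Omega) ((ybar x - y0 x) * v x) +
     charge_integral mubar K v) ->
  charge_integral mubar K (G u \- ybar) <= 0 ->
  0 <= \int[mu]_(x in Omega) ((p x + alpha * ubar x) * (u x - ubar x)) ->
  J Omega G y0 alpha ubar +
  (alpha / 2 * fine (normL Omega 2 (u \- ubar)) ^+ 2 +
   2^-1 * fine (normL Omega 2 (G u \- ybar)) ^+ 2) -
  \int[mu]_(x in Omega) (p x * taylor_rem (G u) ybar x) <= J Omega G y0 alpha u.
Proof.
(* i1 stands for the integral of (ybar - y0) v, i2 for that of ubar w, i4 for that of p w, s for
   that of p times the remainder, and ci for the integral of v against the charge. *)
have lin (a nY nU i1 i2 i4 ci s w2 v2 : R) :
    i4 - s = i1 + ci -> ci <= 0 -> 0 <= i4 + a * i2 ->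
    2^-1 * nY + a / 2 * nU + (a / 2 * w2 + 2^-1 * v2) - s <=
    2^-1 * (nY + 2 * i1 + v2) + a / 2 * (nU + 2 * i2 + w2) by lra.
have aeq (l ph u' p' w v' d : R) :
    l = - ((u' - w) - ph) -> p' * - l + d * p' * v' = p' * (u' - w) - p' * (ph - d * v').
  by move=> ->; ring.
have lapeq (ly lb fy fb uu ub : R) : - ly + fy = uu -> - lb + fb = ub ->
    ly - lb = - ((uu - ub) - (fy - fb)) by move=> <- <-; ring.
have telescope (a b c : R) : a - c = b - c + (a - b) by ring.
move=> y0L pL uL ubL hG syb ybG hadj ci0 hvar.
have sy := hG _ uL; set y := G u in sy ci0 *.
have [[yH10 yH2 cy] eqy] := sy; have [[ybH10 ybH2 cyb] eqyb] := syb.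
pose v := y \- ybar; pose w x := u x - ubar x.
have vH : H10_H2 Omega v.
  split; [exact: H10B|exact: H2B|].
  by move=> x; apply: cvgB; [exact: cy|exact: cyb].
have vL : L2 Omega v by case: vH => -[[]].
have yL : L2 Omega y by case: yH2 => -[].
have ybL : L2 Omega ybar by case: ybH2 => -[].
have wL : L2 Omega w by exact: L2B.
have RL : L2 Omega (taylor_rem y ybar) by exact: taylor_rem_L2.
have dvL : L2 Omega (fun x => derive1 phi (ybar x) * v x).
  apply: (continuous_closure_L2 oO bO) => x; apply: cvgM; first exact: (within_continuous_comp cphi' cyb).
  by apply: cvgB; [exact: cy|exact: cyb].
have lL : L2 Omega (laplacian Omega v) by apply: laplacian_L2; case: vH.
have Ipw := L2_mul mO pL wL; have IpR := L2_mul mO pL RL.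
have Iuw := L2_mul mO ubL wL.
(* Subtracting the state equations gives -Laplace(v) + phi'(ybar) v = w - Rem almost everywhere, and
   p times the left-hand side is the integrand of the adjoint equation tested with v. *)
have adj : \int[mu]_(x in Omega) (p x * w x) - \int[mu]_(x in Omega) (p x * taylor_rem y ybar x) =
    \int[mu]_(x in Omega) ((ybar x - y0 x) * v x) + charge_integral mubar K v.
  apply: (etrans _ (hadj _ vH)).
  apply: (etrans (esym (RintegralB mO Ipw IpR))).
  apply: (ae_eq_Rintegral oO).
  - apply: measurable_funB; apply/measurable_EFinP; [by case/integrableP: Ipw|by case/integrableP: IpR].
  - apply: measurable_funD.
      apply: measurable_funM; first exact: (L2_measurable oO pL).
      exact: (L2_measurable oO (L2N lL)).
    apply: (@eq_measurable_fun _ _ _ _ _ (fun x => p x * (derive1 phi (ybar x) * v x))).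
      by move=> x _; rewrite mulrA [p x * _]mulrC.
    by apply: measurable_funM; [exact: (L2_measurable oO pL)|exact: (L2_measurable oO dvL)].
  - apply: filterS3 (laplacianB oO yH2 ybH2) eqy eqyb => x h hy hyb Ox.
    have h1 := etrans (h Ox) (lapeq _ _ _ _ _ _ (hy Ox) (hyb Ox)).
    by apply: esym; exact: (aeq _ _ _ _ _ _ _ h1).
have hv : 0 <= \int[mu]_(x in Omega) (p x * w x) + alpha * \int[mu]_(x in Omega) (ubar x * w x).
  have Iauw := L2_mul mO (L2Z alpha ubL) wL.
  have e : \int[mu]_(x in Omega) ((p x + alpha * ubar x) * w x) =
      \int[mu]_(x in Omega) (p x * w x) + alpha * \int[mu]_(x in Omega) (ubar x * w x).
    rewrite -(RintegralZl alpha mO Iuw).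
    apply: (@etrans _ _ (\int[mu]_(x in Omega) (p x * w x + alpha * ubar x * w x))).
      by apply: eq_Rintegral => x _; rewrite mulrDl.
    apply: (etrans (RintegralD mO Ipw Iauw)).
    by congr (_ + _); apply: eq_Rintegral => x _; rewrite mulrA.
  by move: hvar; rewrite -/w e.
have eU : fine (normL Omega 2 u) ^+ 2 = fine (normL Omega 2 ubar) ^+ 2 +
    2 * \int[mu]_(x in Omega) (ubar x * w x) + fine (normL Omega 2 w) ^+ 2.
  rewrite -(sqr_normLD ubL wL); congr (fine _ ^+ 2); apply: normL_ext => x _.
  by rewrite /w addrC subrK.
have ybyL := L2B ybL y0L.
have eY : fine (normL Omega 2 (y \- y0)) ^+ 2 = fine (normL Omega 2 (G ubar \- y0)) ^+ 2 +
    2 * \int[mu]_(x in Omega) ((ybar x - y0 x) * v x) + fine (normL Omega 2 v) ^+ 2.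
  have -> : normL Omega 2 (G ubar \- y0) = normL Omega 2 (fun x => ybar x - y0 x).
    by apply: normL_ext => x Ox /=; rewrite ybG.
  rewrite -(sqr_normLD ybyL vL); congr (fine _ ^+ 2); apply: normL_ext => x _ /=.
  exact: telescope.
rewrite /J -/y eU eY.
exact: (lin _ _ _ _ _ _ _ _ _ _ adj ci0 hv).
Qed.

End Comparison.

(** * Global optimality and uniqueness *)

Theorem theorem3p2 (R : realType)
  (Omega : set (plane R)) (hOmega : convex_polygonal_domain Omega)
  (alpha : R) (halpha : 0 < alpha)
  (y0 : plane R -> R) (hy0 : L2 Omega y0)
  (phi : R -> R) (hphi : C2 phi) (phi_incr : {homo phi : s t / s <= t})
  (r M : R) (hr : 1 < r) (hM : 0 < M)
  (hphi'' : forall s, `|derive1n 2 phi s| <= M * (derive1 phi s) `^ (1 / r))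
  (K : set (plane R)) (hK : compact K) (KOmega : K `<=` Omega)
  (ya yb : plane R -> R) (hya : C0 Omega ya) (hyb : C0 Omega yb)
  (hyab : forall x, K x -> ya x < yb x)
  (ua ub : \bar R) (huab : (ua <= ub)%E)
  (G : (plane R -> R) -> (plane R -> R)) (hG : solution_operator Omega phi G)
  (Cq : R) (hCq : 0 < Cq) (hGN : (GN_optimal_constant (q_ r) <= Cq%:E)%E)
  (ubar ybar pbar : plane R -> R) (mubar : {charge set (plane R) -> \bar R})
  (hubar : Uad Omega ua ub ubar)
  (hybar : H10 Omega ybar) (cybar : {within closure Omega, continuous ybar})
  (hpbar : L2 Omega pbar) (hmubar : measure_on K mubar)
  (ybar_ad : Yad K ya yb ybar)
  (hstate : forall v, H10 Omega v ->
     \int[leb2]_(x in Omega) (grad_dot Omega ybar v x + phi (ybar x) * v x) =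
     \int[leb2]_(x in Omega) (ubar x * v x))
  (hadjoint : forall v, H10_H2 Omega v ->
     \int[leb2]_(x in Omega)
       (pbar x * - laplacian Omega v x + derive1 phi (ybar x) * pbar x * v x) =
     \int[leb2]_(x in Omega) ((ybar x - y0 x) * v x) +
     charge_integral mubar K v)
  (hvarineq : forall u, Uad Omega ua ub u ->
     0 <= \int[leb2]_(x in Omega)
            ((pbar x + alpha * ubar x) * (u x - ubar x)))
  (hcompl : forall z, Yad K ya yb z ->
     charge_integral mubar K (z \- ybar) <= 0)
  (heta : (normL Omega (q_ r) pbar <= (eta_ alpha r Cq M)%:E)%E) :
  global_minimum Omega K G y0 alpha ya yb ua ub ubar /\
  ((normL Omega (q_ r) pbar < (eta_ alpha r Cq M)%:E)%E ->
    forall u, global_minimum Omega K G y0 alpha ya yb ua ub u ->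
      {ae @leb2 R, forall x, Omega x -> u x = ubar x}).
Proof.
have [oO _ bO _ _] := hOmega.
have q2 := q_gt2 hr.
have cphi : continuous phi.
  case: hphi => dphi _ _ x; apply: differentiable_continuous.
  by apply/derivable1_diffP.
have [ubL _] := hubar.
(* Equality at every point matters: the constraint on [K], which may be a null set, has to pass from
   [ybar] to [G ubar]. *)
have eqc := state_equation_unique oO bO cphi phi_incr q2 (ltW hCq) hGN ubL
  (hG _ ubL) hybar cybar hstate.
have eqO x : Omega x -> ybar x = G ubar x by move=> Ox; apply: eqc; exact: subset_closure.
have syb := state_equation_ext oO (hG _ ubL) hybar cybar eqO.
have pfin : (normL Omega (q_ r) pbar < +oo)%E by apply: le_lt_trans heta _; exact: ltry.
have pE : normL Omega (q_ r) pbar = (fine (normL Omega (q_ r) pbar))%:E.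
  by rewrite fineK// ge0_fin_numE// Lnorm_ge0.
have eta0 := eta_gt0 hr halpha hM hCq.
have feas : feasible Omega K G ya yb ua ub ubar.
  split => //; have GK x : K x -> G ubar x = ybar x.
    by move=> Kx; rewrite eqO//; exact: KOmega.
  split; last by move=> x Kx; rewrite GK//; exact: ybar_ad.2.
  apply: (continuous_subspaceW _ (_ : {within closure Omega, continuous (G ubar)})).
    by move=> x /KOmega; exact: subset_closure.
  by have [[]] := hG _ ubL.
pose S u := alpha / 2 * fine (normL Omega 2 (u \- ubar)) ^+ 2 +
  2^-1 * fine (normL Omega 2 (G u \- ybar)) ^+ 2.
pose E u := \int[leb2]_(x in Omega) (pbar x * taylor_rem phi (G u) ybar x).
have S0 u : 0 <= S u.
  apply: addr_ge0; apply: mulr_ge0; rewrite ?sqr_ge0 ?invr_ge0//.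
  by rewrite divr_ge0// ltW.
have key u : feasible Omega K G ya yb ua ub u ->
    J Omega G y0 alpha ubar + S u - E u <= J Omega G y0 alpha u /\
    E u * eta_ alpha r Cq M <= fine (normL Omega (q_ r) pbar) * S u.
  move=> [uU uY]; have [uL _] := uU; split.
    apply: (J_lower_bound oO bO hphi hy0 hpbar uL ubL hG syb eqO hadjoint).
      exact: hcompl.
    exact: hvarineq.
  exact: (remainder_estimate oO bO hphi phi_incr hr hM hphi'' halpha hCq hGN uL ubL (hG _ uL) syb hpbar pfin).
split.
  split => // u uF; have [h1 h2] := key u uF; apply: le_trans h1.
  (* It remains to see E <= S, which follows from E eta <= |pbar|_q S <= eta S after division by eta
     > 0. *)
  rewrite -addrA lerDl subr_ge0 -(ler_pM2r eta0) (le_trans h2)// mulrC ler_wpM2l//.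
  by rewrite -lee_fin -pE.
rewrite pE lte_fin => plt u [uF umin]; have [h1 h2] := key u uF.
have [[uL _] _] := uF.
have SE : S u <= E u.
  rewrite -subr_le0 -(lerD2l (J Omega G y0 alpha ubar)) addr0 addrA.
  exact: le_trans h1 (umin _ feas).
(* Minimality gives S <= E, so S eta <= |pbar|_q S; with |pbar|_q < eta this excludes S > 0. *)
have Su : S u = 0.
  apply/eqP; rewrite eq_le S0 andbT leNgt; apply/negP => Spos.
  have := le_trans (ler_wpM2r (ltW eta0) SE) h2.
  by rewrite mulrC ler_pM2r// leNgt plt.
have mO := open_measurable2 oO.
have wL : L2 Omega (u \- ubar) by exact: L2B.
have w0 : \int[leb2]_(x in Omega) ((u \- ubar) x ^+ 2) = 0.
  rewrite -(sqr_normL mO wL); move/eqP: Su; rewrite paddr_eq0; last 2 first.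
  - by rewrite mulr_ge0 ?sqr_ge0// divr_ge0// ltW.
  - by rewrite mulr_ge0 ?sqr_ge0// invr_ge0.
  move=> /andP[+ _]; rewrite mulf_eq0 => /orP[|/eqP//].
  by rewrite gt_eqF// divr_gt0.
have [_ wi] := (L2P _ mO).1 wL.
have := Rintegral_eq0_ae mO wi (fun x _ => sqr_ge0 _) w0.
apply: filterS => x + Ox => /(_ Ox) /eqP.
by rewrite sqrf_eq0 subr_eq0 => /eqP.
Qed.
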